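(* Let $G$ be a locally compact Hausdorff étale groupoid, and let $\Sigma \rightarrow G$ be a twist. Suppose there is a non-zero locally proper negative type function $\psi$ on $G$, and that $G$ has the rapid decay property with respect to the length function $L = \sqrt{\psi}$. Take any $f \in C_r^*(\Sigma; G)$ and let $U$ be the open support of $f$. Then $f$ lies in the closure of $C_c(\Sigma|_U;U)$ in the reduced norm $\|\cdot\|_r$. In particular, the conclusion holds if $G$ is second-countable, satisfies the Haagerup property (so that it admits a non-zero locally proper negative type function $\psi$), and has the rapid decay property with respect to the induced length function $L=\sqrt{\psi}$.
   Context: A twist $\Sigma\rightarrow G$ is a locally trivial central extension $\mathbb{T}\times G^{(0)}\to\Sigma\to G$, determining a line bundle over $G$. $C_c(\Sigma;G)$ is the $*$-algebra of continuous compactly supported sections (convolution, involution $f^*(\gamma)=\overline{f(\gamma^{-1})}$), and $C_r^*(\Sigma;G)$ its completion in the reduced norm $\|\cdot\|_r$ from the left regular representations. The identity on $C_c(\Sigma;G)$ extends to an injective contractive map $C_r^*(\Sigma;G)\to C_0(\Sigma;G)$, by which elements of $C_r^*(\Sigma;G)$ are regarded as sections; the open support of $f$ is $\{\gamma: f(\gamma)\ne0\}$, and $C_c(\Sigma|_U;U)$ is the set of sections in $C_c(\Sigma;G)$ supported in $U$. A locally proper negative type function is a continuous $\psi\colon G\to\mathbb{R}$ with $\psi|_{G^{(0)}}=0$, $\psi(\gamma)=\psi(\gamma^{-1})$, conditionally negative definite (for $x\in G^{(0)}$, $\gamma_1,\dots,\gamma_n\in s^{-1}(x)$, real $\lambda_i$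 with $\sum\lambda_i=0$: $\sum_{i,j}\lambda_i\lambda_j\psi(\gamma_i\gamma_j^{-1})\le0$), and such that $(\psi,r,s)\colon G\to\mathbb{R}\times G^{(0)}\times G^{(0)}$ is proper; its square root $\sqrt\psi$ is a length function ($\ge0$, vanishing on units, symmetric, subadditive). With $\|f\|_{2,p,L}=\max\{\sup_x(\sum_{\gamma\in s^{-1}(x)}|f(\gamma)|^2(1+L(\gamma))^{2p})^{1/2},\sup_x(\sum_{\gamma\in r^{-1}(x)}|f(\gamma)|^2(1+L(\gamma))^{2p})^{1/2}\}$, $G$ has the rapid decay property with respect to $L$ if there exist $c>0$ and $p\in\mathbb{Z}_+$ with $\|f\|_r\le c\|f\|_{2,p,L}$ for all $f\in C_c(\Sigma;G)$. $G$ has the Haagerup property if there is a net $(k_i)$ of positive-definite continuous functions on $G$ (for each $x$ and finite $F\subseteq s^{-1}(x)$, $[k_i(\gamma\eta^{-1})]_{\eta,\gamma\in F}$ is positive semidefinite) such that each $k_i|_{G^{(0)}}=1$, each $k_i$ restricted to $G^K_K=r^{-1}(K)\cap s^{-1}(K)$ lies in $C_0(G^K_K)$ for every compact $K\subseteq G^{(0)}$, and $k_i\to1$ uniformly on compact subsets of $G$; for second-countable $G$ the paper uses that this (in its sequential form) is equivalent to the existence of a non-zero locally proper negative type function. *)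

(* Defs.v *)
(* Complex numbers are R[i] (mathcomp-real-closed),
   given the normed topology of a numFieldType via the alias (R[i])^o. *)
From HB Require Import structures.
From mathcomp Require Import all_boot all_order all_algebra.
From mathcomp Require Import complex.
From mathcomp Require Import all_classical all_reals all_analysis.
Import Order.TTheory GRing.Theory Num.Theory.
Import numFieldNormedType.Exports numFieldTopology.Exports.

Set Implicit Arguments.
Unset Strict Implicit.
Unset Printing Implicit Defensive.

Local Open Scope classical_set_scope.
Local Open Scope ring_scope.

Notation Cx R := ((R[i])^o).

Definition cabs (R : realType) (z : Cx R) : R :=
  Num.sqrt (complex.Re z ^+ 2 + complex.Im z ^+ 2).

Definition circle (R : realType) (z : Cx R) : Prop := cabs z = 1.

(* square root on extended reals (-oo, i.e. a sup over the empty set, gives 0) *)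
Definition esqrt (R : realType) (x : \bar R) : \bar R :=
  match x with
  | r%:E => (Num.sqrt r)%:E
  | +oo%E => +oo%E
  | -oo%E => 0%E
  end.

Record groupoid (T : Type) := Groupoid {
  g_unit : set T ;
  g_r : T -> T ;
  g_s : T -> T ;
  g_mul : T -> T -> T ;   (* meaningful on composable pairs g_s g = g_r h *)
  g_inv : T -> T }.

Definition is_groupoid (T : Type) (G : groupoid T) : Prop :=
  [/\ (forall x, g_unit G x -> g_r G x = x /\ g_s G x = x),
      (forall g, g_unit G (g_r G g) /\ g_unit G (g_s G g)),
      (forall g h, g_s G g = g_r G h ->
         g_r G (g_mul G g h) = g_r G g /\ g_s G (g_mul G g h) = g_s G h),
      (forall g h k, g_s G g = g_r G h -> g_s G h = g_r G k ->
         g_mul G (g_mul G g h) k = g_mul G g (g_mul G h k)) &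
      (forall g, g_mul G (g_r G g) g = g /\ g_mul G g (g_s G g) = g)] /\
      (forall g, [/\ g_r G (g_inv G g) = g_s G g, g_s G (g_inv G g) = g_r G g,
                     g_mul G (g_inv G g) g = g_s G g &
                     g_mul G g (g_inv G g) = g_r G g]).

Definition is_top_groupoid (T : topologicalType) (G : groupoid T) : Prop :=
  [/\ is_groupoid G,
      {within [set p : T * T | g_s G p.1 = g_r G p.2],
         continuous (fun p : T * T => g_mul G p.1 p.2)},
      continuous (g_inv G), continuous (g_r G) & continuous (g_s G)].

Definition local_homeo (T : topologicalType) (r : T -> T) : Prop :=
  continuous r /\
  forall g, exists U : set T, [/\ open U, U g,
     (forall a b, U a -> U b -> r a = r b -> a = b) &
     (forall V, open V -> V `<=` U -> open (r @` V))].

Definition lch_etale_groupoid (T : topologicalType) (G : groupoid T) : Prop :=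
  [/\ is_top_groupoid G, local_homeo (g_r G),
      hausdorff_space T & locally_compact [set: T]].

Record twist (R : realType) (T : topologicalType) (G : groupoid T) := Twist {
  tw_sp : topologicalType ;
  tw_gpd : groupoid tw_sp ;
  tw_pi : tw_sp -> T ;
  tw_iota : Cx R -> T -> tw_sp }.
Arguments tw_sp {R T G} t.
Arguments tw_gpd {R T G} t.
Arguments tw_pi {R T G} t _.
Arguments tw_iota {R T G} t _ _.
Arguments g_unit {T} g _.
Arguments g_r {T} g _.
Arguments g_s {T} g _.
Arguments g_mul {T} g _ _.
Arguments g_inv {T} g _.

Section Twist.
Variables (R : realType) (T : topologicalType) (G : groupoid T) (S : twist R G).

Local Notation Sg := (tw_sp S).
Local Notation pi := (tw_pi S).
Local Notation iota := (tw_iota S).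
Local Notation SG := (tw_gpd S).

Definition tw_act (z : Cx R) (sigma : Sg) : Sg :=
  g_mul SG (iota z (g_r G (pi sigma))) sigma.

Definition is_twist : Prop :=
  [/\
      [/\ is_top_groupoid SG, hausdorff_space Sg & locally_compact [set: Sg]],
      ([/\ continuous pi, (forall V : set Sg, open V -> open (pi @` V)),
          (forall g, exists sigma, pi sigma = g),
          (forall sigma tau, g_s SG sigma = g_r SG tau ->
              pi (g_mul SG sigma tau) = g_mul G (pi sigma) (pi tau)) &
          (forall sigma, pi (g_inv SG sigma) = g_inv G (pi sigma))] /\
          (forall sigma, pi (g_r SG sigma) = g_r G (pi sigma) /\
                         pi (g_s SG sigma) = g_s G (pi sigma))),
      (* iota : T x G^0 -> Sigma is an injective groupoid morphism of the
         trivial group bundle, a homeomorphism onto pi^{-1}(G^0) *)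
      ([/\ (forall z x, circle z -> g_unit G x ->
             [/\ pi (iota z x) = x, g_r SG (iota z x) = iota 1 x &
                 g_s SG (iota z x) = iota 1 x]),
          (forall z w x, circle z -> circle w -> g_unit G x ->
             g_mul SG (iota z x) (iota w x) = iota (z * w) x),
          (forall z w x y, circle z -> circle w -> g_unit G x -> g_unit G y ->
             iota z x = iota w y -> z = w /\ x = y) &
          (forall sigma, g_unit G (pi sigma) ->
             exists z x, [/\ circle z, g_unit G x & sigma = iota z x])] /\
       ({within [set p : Cx R * T | circle p.1 /\ g_unit G p.2],
             continuous (fun p : Cx R * T => iota p.1 p.2)} /\
        (forall W : set (Cx R * T), open W -> exists O : set Sg, open O /\
             (fun p : Cx R * T => iota p.1 p.2) @`
                (W `&` [set p | circle p.1 /\ g_unit G p.2])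
             = O `&` [set sigma | g_unit G (pi sigma)]))),
      (forall sigma tau, pi sigma = pi tau ->
          exists z, circle z /\ tau = tw_act z sigma) &
      (forall z sigma, circle z ->
          tw_act z sigma = g_mul SG sigma (iota z (g_s G (pi sigma))))] /\
  (forall g, exists (U : set T) (sec : T -> Sg),
      [/\ open U, U g, {within U, continuous sec} &
          forall h, U h -> pi (sec h) = h]).

(* Sections of the line bundle *)
Definition equivariant (f : Sg -> Cx R) : Prop :=
  forall z sigma, circle z -> f (tw_act z sigma) = z * f sigma.

Definition osupp (f : Sg -> Cx R) : set T :=
  [set g | exists sigma, pi sigma = g /\ f sigma != 0].

Definition Cc (f : Sg -> Cx R) : Prop :=
  [/\ continuous f, equivariant f & compact (closure (osupp f))].

(* C_c(Sigma|_U; U) : sections of C_c(Sigma;G) supported in U *)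
Definition Cc_on (U : set T) (f : Sg -> Cx R) : Prop :=
  Cc f /\ closure (osupp f) `<=` U.

Definition at_lift (V : Type) (d : V) (F : Sg -> V) (g : T) : V :=
  match pselect (exists sigma, pi sigma = g) with
  | left h => F (proj1_sig (cid h))
  | right _ => d
  end.

Definition sfib (x : T) : set T := [set g | g_s G g = x].
Definition rfib (x : T) : set T := [set g | g_r G g = x].

Definition l2norm2 (x : T) (xi : Sg -> Cx R) : \bar R :=
  (\esum_(g in sfib x) ((cabs (at_lift 0 xi g)) ^+ 2)%:E)%E.

Definition in_l2 (x : T) (xi : Sg -> Cx R) : Prop :=
  [/\ equivariant xi, (forall sigma, g_s G (pi sigma) <> x -> xi sigma = 0)
    & (l2norm2 x xi < +oo)%E].

Definition regrep (x : T) (f xi : Sg -> Cx R) : Sg -> Cx R :=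
  fun sigma => \sum_(g \in sfib x)
     at_lift 0 (fun tau => f (g_mul SG sigma (g_inv SG tau)) * xi tau) g.

Definition opnorm2 (x : T) (f : Sg -> Cx R) : \bar R :=
  ereal_sup [set l2norm2 x (regrep x f xi) |
             xi in [set xi | in_l2 x xi /\ (l2norm2 x xi <= 1)%E]].

Definition rnorm (f : Sg -> Cx R) : \bar R :=
  esqrt (ereal_sup [set opnorm2 x f | x in g_unit G]).

(* (fn) is a ||.||_r-Cauchy sequence in C_c(Sigma;G) whose image in
   C_0(Sigma;G) (uniform limit) is f *)
Definition represents (fn : nat -> Sg -> Cx R) (f : Sg -> Cx R) : Prop :=
  [/\ (forall n, Cc (fn n)),
      (forall eps : R, 0 < eps -> exists N, forall m n, (N <= m)%N -> (N <= n)%N ->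
          (rnorm (fun sigma => (fn m sigma - fn n sigma)%R) < eps%:E)%E) &
      (forall eps : R, 0 < eps -> exists N, forall n, (N <= n)%N ->
          forall sigma, cabs (fn n sigma - f sigma) < eps)].

Definition in_Cr (f : Sg -> Cx R) : Prop := exists fn, represents fn f.

Definition norm2pL (L : T -> R) (p : nat) (f : Sg -> Cx R) : \bar R :=
  Order.max
    (esqrt (ereal_sup [set (\esum_(g in sfib x)
        ((cabs (at_lift 0 f g)) ^+ 2 * (1 + L g) ^+ (2 * p))%:E)%E
        | x in g_unit G]))
    (esqrt (ereal_sup [set (\esum_(g in rfib x)
        ((cabs (at_lift 0 f g)) ^+ 2 * (1 + L g) ^+ (2 * p))%:E)%E
        | x in g_unit G])).

Definition rapid_decay (L : T -> R) : Prop :=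
  exists c : R, 0 < c /\ exists p : nat,
    forall f, Cc f -> (rnorm f <= c%:E * norm2pL L p f)%E.

End Twist.

Definition cond_neg_def (R : realType) (T : Type) (G : groupoid T)
  (psi : T -> R) : Prop :=
  forall (x : T) (n : nat) (gam : 'I_n -> T) (lam : 'I_n -> R),
    g_unit G x -> (forall i, g_s G (gam i) = x) -> \sum_(i < n) lam i = 0 ->
    \sum_(i < n) \sum_(j < n) lam i * lam j * psi (g_mul G (gam i) (g_inv G (gam j)))
      <= 0.

Definition loc_proper_neg_type (R : realType) (T : topologicalType)
  (G : groupoid T) (psi : T -> R) : Prop :=
  [/\ continuous psi,
      (forall x, g_unit G x -> psi x = 0),
      (forall g, psi (g_inv G g) = psi g),
      cond_neg_def G psi &
      (forall K : set (R * T * T), compact K ->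
          compact ((fun g => (psi g, g_r G g, g_s G g)) @^-1` K))].

(* Main.v *)
Require Import Defs.
From HB Require Import structures.
From mathcomp Require Import all_boot all_order all_algebra.
From mathcomp Require Import complex finmap.
From mathcomp Require Import all_classical all_reals all_analysis.
From mathcomp Require Import ring lra.
Import Order.TTheory GRing.Theory Num.Theory.
Import numFieldNormedType.Exports numFieldTopology.Exports.

(* By Schoenberg's theorem [exp (- t psi)] is positive definite, so pointwise
   multiplication by it is a contraction for the reduced norm; by rapid decay it
   moves a given element of [C_c] by a small amount when [t] is small. Since
   [exp (- t L^2)] beats every power of [1 + L], after multiplication the
   [(2, p, L)]-norm, hence the reduced norm, is controlled by the plain 2-norm of
   the section, which is itself at most the reduced norm. It remains to truncate
   [exp (- t psi) f_M] near the zeros of [f_M]: cutting off below height [d], with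
   [d] larger than the uniform distance from [f_M] to [f], puts the support inside
   that of [f]; the removed part is small in 2-norm uniformly over the fibres,
   because a fixed earlier [f_N1] is close to [f_M] in 2-norm and the fibres of
   its compact support are uniformly finite. *)

Set Implicit Arguments.
Unset Strict Implicit.
Unset Printing Implicit Defensive.

Local Open Scope classical_set_scope.
Local Open Scope ring_scope.
Local Open Scope complex_scope.


(** * Positive kernels on finite sets *)

Section PositiveKernels.
Context {R : realType} {I : finType}.
Implicit Types (K P : I -> I -> R) (c : I -> R).

Definition quad_form K c : R := \sum_i \sum_j c i * c j * K i j.

Definition pos_kernel K : Prop :=
  (forall i j, K i j = K j i) /\ (forall c, 0 <= quad_form K c).

Lemma sum_delta c i : \sum_j (j == i)%:R * c j = c i.
Proof.
rewrite (bigD1 i)//= eqxx mul1r big1 ?addr0// => j /negbTE ->.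
by rewrite mul0r.
Qed.

Lemma quad_form_two K i j (a b : R) : (forall i j, K i j = K j i) ->
  quad_form K (fun k => a * (k == i)%:R + b * (k == j)%:R) =
  a ^+ 2 * K i i + 2 * a * b * K i j + b ^+ 2 * K j j.
Proof.
move=> Ksym; rewrite /quad_form.
have row k : \sum_l (a * (k == i)%:R + b * (k == j)%:R) *
      (a * (l == i)%:R + b * (l == j)%:R) * K k l =
    (k == i)%:R * (a * (a * K k i + b * K k j)) +
    (k == j)%:R * (b * (a * K k i + b * K k j)).
  rewrite (eq_bigr (fun l => (l == i)%:R * ((a * (k == i)%:R + b * (k == j)%:R) * a * K k l)
     + (l == j)%:R * ((a * (k == i)%:R + b * (k == j)%:R) * b * K k l))); last first.
    by move=> l _; ring.
  rewrite big_split/= !sum_delta; ring.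
under eq_bigr do rewrite row.
rewrite big_split/= !sum_delta (Ksym j i); ring.
Qed.

Lemma pos_kernel_diag_ge0 K i : pos_kernel K -> 0 <= K i i.
Proof.
move=> [Ks /(_ (fun k => 1 * (k == i)%:R + 0 * (k == i)%:R))].
by rewrite quad_form_two//; lra.
Qed.

(** The test vector with entries [- (K j j + 1)] at [i] and [K i j] at [j] gives the form the value
    [- (K j j + 2) * K i j ^+ 2]. The added 1 covers the case [K j j = 0]. *)
Lemma pos_kernel_diag0 K i (j : I) : pos_kernel K -> K i i = 0 -> K i j = 0.
Proof.
move=> pK Kii; have Kjj := pos_kernel_diag_ge0 j pK; case: pK => Ks pK.
have := pK (fun k => (- (K j j + 1)) * (k == i)%:R + K i j * (k == j)%:R).
rewrite quad_form_two// Kii => h.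
apply/eqP; rewrite -sqrf_eq0 eq_le sqr_ge0 andbT.
by nra.
Qed.

(* Cholesky: [K - K _ i K i _ / K i i] is still positive and has one more
   vanishing diagonal entry. *)
Lemma pos_kernel_gram K : pos_kernel K ->
  exists (m : nat) (v : 'I_m -> I -> R),
    forall i j, K i j = \sum_(l < m) v l i * v l j.
Proof.
have [n] := ubnP #|[pred i | K i i != 0]|.
elim: n K => // n IH K; rewrite ltnS => Kn pK.
have [[i Ki]|/forallNP K0] := pselect (exists i, K i i != 0); last first.
  exists 0%N, (fun _ _ => 0) => i j; rewrite big_ord0.

  by apply: (pos_kernel_diag0 _ pK); apply/eqP/negPn/negP/K0.
have [Ks pK2] := pK.
have Ki0 : 0 < K i i by rewrite lt_def Ki pos_kernel_diag_ge0.
pose K' k l := K k l - K k i * K l i / K i i.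
have pK' : pos_kernel K'.
  split=> [k l|c]; first by rewrite /K' Ks [K k i * _]mulrC.
  set s := \sum_k c k * K k i.
  (* Completing the square: [s / K i i] is the shift of the coordinate [i] that minimises the form
     of [K], and the minimum is the form of [K']. *)
  have -> : quad_form K' c = quad_form K (fun k => c k - (s / K i i) * (k == i)%:R).
    rewrite /quad_form.
    have E1 k : \sum_l c k * c l * K' k l =
        \sum_l c k * c l * K k l - c k * K k i / K i i * s.
      rewrite /s mulr_sumr -sumrB; apply: eq_bigr => l _; rewrite /K'; ring.
    have E2 k : \sum_l (c k - s / K i i * (k == i)%:R) *
         (c l - s / K i i * (l == i)%:R) * K k l =
        \sum_l c k * c l * K k l - c k * K k i * (s / K i i)
        - (k == i)%:R * (s / K i i * (\sum_l c l * K k l - (s / K i i) * K k i)).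
      have -> : c k * K k i = \sum_l (l == i)%:R * (c k * K k l).
        by rewrite sum_delta.
      have -> : \sum_l c l * K k l - s / K i i * K k i =
          \sum_l (c l * K k l - (l == i)%:R * (s / K i i * K k l)).
        by rewrite sumrB sum_delta.
      move: (s / K i i) => r.
      rewrite !mulr_sumr !mulr_suml -!sumrB; apply: eq_bigr => l _; ring.
    rewrite (eq_bigr _ (fun k _ => E1 k)) (eq_bigr _ (fun k _ => E2 k)).
    rewrite !sumrB sum_delta -!mulr_suml.
    have -> : \sum_l c l * K i l = s by apply: eq_bigr => l _; rewrite Ks.
    rewrite -/s; field; exact: Ki.
  exact: pK2.
have K'i k : K' k i = 0 by rewrite /K'; field.
have [|m [v Ev]] := IH K' _ pK'.
  (* A vanishing diagonal entry of [K] has a vanishing row, so it stays zero in [K']. The entry at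
     [i] becomes zero, so the count strictly drops. *)
  apply: leq_trans Kn; apply: proper_card; apply/properP; split.
    apply/fintype.subsetP => k; rewrite !inE; apply: contra => /eqP Kk.
    have := pos_kernel_diag_ge0 k pK'; rewrite /K' Kk sub0r => h.
    by rewrite (pos_kernel_diag0 _ pK Kk) mul0r mul0r oppr0.
  by exists i; rewrite !inE ?K'i ?eqxx.
exists m.+1, (fun l k => if unlift ord0 l is Some l' then v l' k
                         else K k i / Num.sqrt (K i i)) => k l.
rewrite big_ord_recl unlift_none.
under eq_bigr do rewrite liftK.
rewrite -Ev /K' mulf_div -expr2 sqr_sqrtr ?ltW//; ring.
Qed.

(** Schur product theorem: with [K] in Gram form, the form of the product at [c] is the sum over [l]
    of the forms of [P] at the vectors [c i * v l i]. *)
Lemma pos_kernelM P K : pos_kernel P -> pos_kernel K ->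
  pos_kernel (fun i j => P i j * K i j).
Proof.
move=> [Ps pP] pK; split=> [i j|c]; first by rewrite Ps pK.1.
have [m [v Ev]] := pos_kernel_gram pK.
suff -> : quad_form (fun i j => P i j * K i j) c =
    \sum_(l < m) quad_form P (fun i => c i * v l i).
  by apply: sumr_ge0 => l _; exact: pP.
rewrite /quad_form [RHS]exchange_big/=; apply: eq_bigr => i _.
rewrite [RHS]exchange_big/=; apply: eq_bigr => j _.
by rewrite Ev !mulr_sumr; apply: eq_bigr => l _; ring.
Qed.

Lemma pos_kernelX K m : pos_kernel K -> pos_kernel (fun i j => K i j ^+ m).
Proof.
move=> pK; elim: m => [|m IH].
  split=> // c; rewrite /quad_form.
  under eq_bigr do under eq_bigr do rewrite expr0 mulr1.
  by under eq_bigr do rewrite -mulr_sumr; rewrite -mulr_suml -expr2 sqr_ge0.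
have /= := pos_kernelM IH pK; congr pos_kernel; apply/funext => i; apply/funext => j.
by rewrite exprSr.
Qed.

(** The partial sums of the exponential series are nonnegative combinations of entrywise powers of
    [K], and nonnegativity of the form passes to the limit. *)
Lemma pos_kernel_expR K : pos_kernel K -> pos_kernel (fun i j => expR (K i j)).
Proof.
move=> pK; split=> [i j|c]; first by rewrite pK.1.
pose q n := quad_form (fun i j => series (exp_coeff (K i j)) n) c.
have qcvg : q n @[n --> \oo] --> quad_form (fun i j => expR (K i j)) c.
  apply: cvg_big => [|i _]; first exact: add_continuous.
  apply: cvg_big => [|j _]; first exact: add_continuous.
  apply: cvgMl_tmp; exact: is_cvg_series_exp_coeff.
have q0 n : 0 <= q n.
  have -> : q n = \sum_(0 <= k < n) (k`!%:R)^-1 * quad_form (fun i j => K i j ^+ k) c.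
    rewrite /q /quad_form /series/=.
    under [RHS]eq_bigr do rewrite mulr_sumr.
    rewrite [RHS]exchange_big/=; apply: eq_bigr => i _.
    under [RHS]eq_bigr do rewrite mulr_sumr.
    rewrite [RHS]exchange_big/=; apply: eq_bigr => j _.
    rewrite mulr_sumr; apply: eq_bigr => k _; rewrite /exp_coeff/=; ring.
  apply: sumr_ge0 => k _; rewrite mulr_ge0 ?invr_ge0 ?ler0n//.
  by have [] := pos_kernelX k pK.
rewrite -(cvg_lim _ qcvg)//; apply: limr_ge; first by apply/cvg_ex; eexists; exact: qcvg.
by near=> n.
Unshelve. all: by end_near. Qed.

(* Schoenberg: [N i j = a i + a j - K i j] turns [exp (- t N)] into
   [exp (- t a i) exp (- t a j) exp (t K i j)]. *)
Lemma pos_kernel_schoenberg (N : I -> I -> R) (a : I -> R) (t : R) : 0 <= t ->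
  pos_kernel (fun i j => a i + a j - N i j) ->
  pos_kernel (fun i j => expR (- t * N i j)).
Proof.
move=> t0 [Ks pK].
have [//|Es pE] := @pos_kernel_expR (fun i j => t * (a i + a j - N i j)).
  split=> [i j|c]; first by rewrite Ks.
  rewrite (_ : quad_form _ _ = t * quad_form (fun i j => a i + a j - N i j) c) ?mulr_ge0//.
  rewrite /quad_form mulr_sumr; apply: eq_bigr => i _.
  by rewrite mulr_sumr; apply: eq_bigr => j _; ring.
split=> [i j|c].
  by have := Ks i j; rewrite [a j + _]addrC => /addrI/oppr_inj ->.
have := pE (fun i => c i * expR (- t * a i)); congr (0 <= _).
apply: eq_bigr => i _; apply: eq_bigr => j _.
rewrite mulrACA -!mulrA -!expRD; congr (_ * (_ * expR _)); ring.
Qed.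

End PositiveKernels.

(** By Lagrange's identity, twice the difference of the two sides is a sum of squares. *)
Lemma cauchy_schwarz_sum {R : realType} (I : finType) (u w : I -> R) :
  (\sum_i u i * w i) ^+ 2 <= (\sum_i u i ^+ 2) * (\sum_i w i ^+ 2).
Proof.
rewrite -subr_ge0.
have : 0 <= \sum_i \sum_j (u i * w j - u j * w i) ^+ 2.
  by apply: sumr_ge0 => i _; apply: sumr_ge0 => j _; exact: sqr_ge0.
have -> : \sum_i \sum_j (u i * w j - u j * w i) ^+ 2 =
   2 * ((\sum_i u i ^+ 2) * (\sum_i w i ^+ 2) - (\sum_i u i * w i) ^+ 2); last by lra.
have -> : \sum_i \sum_j (u i * w j - u j * w i) ^+ 2 =
   \sum_i \sum_j u i ^+ 2 * w j ^+ 2 + \sum_i \sum_j w i ^+ 2 * u j ^+ 2 -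
   2 * \sum_i \sum_j (u i * w i) * (u j * w j).
  rewrite mulr_sumr -big_split -sumrB/=; apply: eq_bigr => i _.
  rewrite mulr_sumr -big_split -sumrB/=; apply: eq_bigr => j _; ring.
have fact (x y : I -> R) : \sum_i \sum_j x i * y j = (\sum_i x i) * (\sum_j y j).
  by rewrite mulr_suml; apply: eq_bigr => i _; rewrite mulr_sumr.
by rewrite !fact; ring.
Qed.

(** * Modulus of complex numbers *)

Section Modulus.
Context {R : realType}.
Implicit Types z w : Cx R.

Lemma normcE_cabs z : `|z| = (cabs z)%:C :> R[i].
Proof. by rewrite normc_def. Qed.

Lemma cabs_ge0 z : 0 <= cabs z.
Proof. exact: sqrtr_ge0. Qed.

Lemma cabs_inj_real (x y : R) : x%:C = y%:C :> R[i] -> x = y.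
Proof. by case. Qed.

Lemma cabsM z w : cabs (z * w) = cabs z * cabs w.
Proof. by apply: cabs_inj_real; rewrite rmorphM/= -!normcE_cabs normrM. Qed.

Lemma cabsD z w : cabs (z + w) <= cabs z + cabs w.
Proof. by rewrite -lecR rmorphD/= -!normcE_cabs ler_normD. Qed.

Lemma cabsN z : cabs (- z) = cabs z.
Proof. by apply: cabs_inj_real; rewrite -!normcE_cabs normrN. Qed.

Lemma cabsB z w : cabs (z - w) = cabs (w - z).
Proof. by rewrite -cabsN opprB. Qed.

Lemma cabs0 : cabs (0 : Cx R) = 0.
Proof. by apply: cabs_inj_real; rewrite -!normcE_cabs normr0. Qed.

Lemma cabs_eq0 z : (cabs z == 0) = (z == 0).
Proof.
rewrite -[RHS]normr_eq0 normcE_cabs; apply/eqP/eqP => [->//|].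
exact: cabs_inj_real.
Qed.

Lemma cabs_real (x : R) : 0 <= x -> cabs (x%:C : Cx R) = x.
Proof. by move=> x0; rewrite /cabs/= expr0n addr0 sqrtr_sqr ger0_norm. Qed.

Lemma cabs_conj z : cabs (z^*%C : Cx R) = cabs z.
Proof. by case: z => a b; rewrite /cabs/= sqrrN. Qed.

Lemma mul_conj z : z * (z^*%C : Cx R) = (cabs z ^+ 2)%:C.
Proof. by rewrite rmorphXn/= -normcE_cabs sqr_normc. Qed.

Lemma circle1 : circle (1 : Cx R).
Proof. by rewrite /circle; apply: cabs_inj_real; rewrite -normcE_cabs normr1. Qed.

Lemma circleM z w : circle z -> circle w -> circle (z * w).
Proof. by rewrite /circle cabsM => -> ->; rewrite mulr1. Qed.

Lemma cabs_sum (J : Type) (s : seq J) (F : J -> Cx R) :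
  cabs (\sum_(j <- s) F j) <= \sum_(j <- s) cabs (F j).
Proof.
elim: s => [|j s IH]; first by rewrite !big_nil cabs0.
by rewrite !big_cons; apply: le_trans (cabsD _ _) _; rewrite lerD2l.
Qed.

Lemma cabs_distr z w : `|cabs z - cabs w| <= cabs (z - w).
Proof.
rewrite ler_norml; apply/andP; split.
  by rewrite lerBrDr addrC lerBlDr cabsB -{1}(subrK z w) addrC cabsD.
by rewrite lerBlDr -{1}(subrK w z) cabsD.
Qed.

Lemma sqr_cabsD z w : cabs (z + w) ^+ 2 <= 2 * (cabs z ^+ 2 + cabs w ^+ 2).
Proof.
have := cabsD z w; have := cabs_ge0 (z + w); have := cabs_ge0 z; have := cabs_ge0 w.
move: (cabs _) (cabs z) (cabs w) => a b c *.
have : a ^+ 2 <= (b + c) ^+ 2 by rewrite ler_sqr// nnegrE addr_ge0.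
by have := sqr_ge0 (b - c); nra.
Qed.

Lemma cabs_sum_sqr (J : finType) (v : J -> R) (z : J -> Cx R) :
  cabs (\sum_j (v j)%:C * z j) ^+ 2 <=
  (\sum_j v j ^+ 2) * (\sum_j cabs (z j) ^+ 2).
Proof.
have h : cabs (\sum_j (v j)%:C * z j) <= \sum_j `|v j| * cabs (z j).
  apply: le_trans (cabs_sum _ _) _; apply: ler_sum => j _.
  by rewrite cabsM {1}/cabs/= expr0n/= addr0 sqrtr_sqr.
have := cauchy_schwarz_sum (fun j => `|v j|) (fun j => cabs (z j)).
under [in X in _ <= X -> _]eq_bigr do rewrite real_normK ?num_real//.
by apply: le_trans; rewrite ler_sqr ?nnegrE ?cabs_ge0// (le_trans (cabs_ge0 _) h).
Qed.

Lemma continuous_cabs (X : topologicalType) (u : X -> Cx R) :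
  continuous u -> continuous (fun x => cabs (u x)).
Proof.
move=> cu x; apply/cvgrPdist_lt => e e0.
have /cvgrPdist_lt/(_ e%:C) := cu x; rewrite ltcR => /(_ e0).
apply: filterS => y; rewrite normcE_cabs ltcR.
by apply: le_lt_trans; exact: cabs_distr.
Qed.

Lemma continuous_realC (X : topologicalType) (u : X -> R) :
  continuous u -> continuous (fun x => (u x)%:C : Cx R).
Proof.
move=> cu x; apply/(@cvgrPdist_lt _ (Cx R)) => e e0.
(* A positive element of [R[i]] has zero imaginary part, so the radius is a real number. *)
case: e e0 => e e' /=; rewrite ltcE/= => /andP[/eqP -> e0].
have /cvgrPdist_lt/(_ e e0) := cu x.
apply: filterS => y h; rewrite -[_ - _]rmorphB normcE_cabs ltcR.
by rewrite /cabs/= expr0n/= addr0 sqrtr_sqr.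
Qed.

End Modulus.

(** * Twists *)

Section Groupoid.
Context {T : Type} {G : groupoid T} (GG : is_groupoid G).
Implicit Types (g h k x : T).
Local Notation r := (g_r G).
Local Notation s := (g_s G).
Local Notation "g ** h" := (g_mul G g h) (at level 40).
Local Notation inv := (g_inv G).

Lemma unit_r x : g_unit G x -> r x = x.
Proof. by have [[h _ _ _ _] _] := GG; move=> /h[]. Qed.

Lemma unit_s x : g_unit G x -> s x = x.
Proof. by have [[h _ _ _ _] _] := GG; move=> /h[]. Qed.

Lemma r_unit g : g_unit G (r g).
Proof. by have [[_ h _ _ _] _] := GG; case: (h g). Qed.

Lemma s_unit g : g_unit G (s g).
Proof. by have [[_ h _ _ _] _] := GG; case: (h g). Qed.

Lemma r_mul g h : s g = r h -> r (g ** h) = r g.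
Proof. by have [[_ _ c _ _] _] := GG; move=> /c[]. Qed.

Lemma s_mul g h : s g = r h -> s (g ** h) = s h.
Proof. by have [[_ _ c _ _] _] := GG; move=> /c[]. Qed.

Lemma gmulA g h k : s g = r h -> s h = r k -> (g ** h) ** k = g ** (h ** k).
Proof. by have [[_ _ _ c _] _] := GG; exact: c. Qed.

Lemma mul_r g : r g ** g = g.
Proof. by have [[_ _ _ _ c] _] := GG; case: (c g). Qed.

Lemma mul_s g : g ** s g = g.
Proof. by have [[_ _ _ _ c] _] := GG; case: (c g). Qed.

Lemma r_inv g : r (inv g) = s g.
Proof. by have [_ c] := GG; case: (c g). Qed.

Lemma s_inv g : s (inv g) = r g.
Proof. by have [_ c] := GG; case: (c g). Qed.

Lemma gmulVg g : inv g ** g = s g.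
Proof. by have [_ c] := GG; case: (c g). Qed.

Lemma gmulgV g : g ** inv g = r g.
Proof. by have [_ c] := GG; case: (c g). Qed.

Lemma gmulK g h : s g = r h -> (g ** h) ** inv h = g.
Proof. by move=> c; rewrite gmulA ?r_inv// gmulgV -c mul_s. Qed.

Lemma ginvK g : inv (inv g) = g.
Proof.
have c : s (inv (inv g)) = r (inv g) by rewrite s_inv.
have c' : s (inv g) = r g by rewrite s_inv.
by rewrite -[LHS]mul_s c r_inv -gmulVg -(gmulA c c') gmulVg c' mul_r.
Qed.

Lemma ginv_unit x : g_unit G x -> inv x = x.
Proof.
by move=> ux; rewrite -[LHS]mul_r r_inv unit_s// gmulgV unit_r.
Qed.

Lemma gmul_unit g x : g_unit G x -> s g = x -> g ** x = g.
Proof. by move=> _ <-; exact: mul_s. Qed.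

Lemma gmulV_inj g h h' : s g = s h -> s g = s h' ->
  g ** inv h = g ** inv h' -> h = h'.
Proof.
move=> c c' e; rewrite -[h]ginvK -[h']ginvK; congr inv.
have k u : s g = s u -> inv g ** (g ** inv u) = inv u.
  by move=> cu; rewrite -gmulA ?s_inv ?r_inv// gmulVg cu -r_inv mul_r.
by rewrite -(k h c) e k.
Qed.

(** Uniqueness of inverses: the candidate is a right inverse of [g ** h], and multiplying on the
    left by [inv (g ** h)] identifies the two. *)
Lemma ginvM g h : s g = r h -> inv (g ** h) = inv h ** inv g.
Proof.
move=> c; have c' : s (inv h) = r (inv g) by rewrite s_inv r_inv.
have cm : s (g ** h) = r (inv h) by rewrite s_mul// r_inv.
have E : (g ** h) ** (inv h ** inv g) = r g.
  by rewrite -(gmulA cm c') gmulK// gmulgV.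
have cu : s (inv (g ** h)) = r (g ** h) by rewrite s_inv.
have cv : s (g ** h) = r (inv h ** inv g) by rewrite r_mul.
rewrite -[LHS]mul_s cu r_mul// -E -(gmulA cu cv) gmulVg cv.
exact: mul_r.
Qed.

End Groupoid.

(** * Phases, lifts and equivariant sections of a twist *)

Section TwistAlgebra.
Context {R : realType} {T : topologicalType} {G : groupoid T} {S : twist R G}.
Hypotheses (GG : is_groupoid G) (HS : is_twist S).
Local Notation Sg := (tw_sp S).
Local Notation pi := (tw_pi S).
Local Notation iota := (tw_iota S).
Local Notation SG := (tw_gpd S).
Implicit Types (z w : Cx R) (sigma tau : Sg) (x y g h : T) (f : Sg -> Cx R).

Lemma twist_groupoid : is_groupoid SG.
Proof. by case: HS => [[[[]]]]. Qed.
Local Notation GS := twist_groupoid.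

Lemma pi_surj g : exists sigma, pi sigma = g.
Proof. by case: HS => [[_ [[]]]]. Qed.

Lemma pi_open (V : set Sg) : open V -> open (pi @` V).
Proof. by case: HS => [[_ [[_ h _ _ _] _] _ _ _] _]; exact: h. Qed.

Lemma pi_continuous : continuous pi.
Proof. by case: HS => [[_ [[]]]]. Qed.

Lemma pi_mul sigma tau : g_s SG sigma = g_r SG tau ->
  pi (g_mul SG sigma tau) = g_mul G (pi sigma) (pi tau).
Proof. by case: HS => [[_ [[_ _ _ h _] _] _ _ _] _]; exact: h. Qed.

Lemma pi_inv sigma : pi (g_inv SG sigma) = g_inv G (pi sigma).
Proof. by case: HS => [[_ [[]]]]. Qed.

Lemma pi_r sigma : pi (g_r SG sigma) = g_r G (pi sigma).
Proof. by case: HS => [[_ [_ h] _ _ _] _]; case: (h sigma). Qed.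

Lemma pi_s sigma : pi (g_s SG sigma) = g_s G (pi sigma).
Proof. by case: HS => [[_ [_ h] _ _ _] _]; case: (h sigma). Qed.

Lemma iota_fib z x : circle z -> g_unit G x ->
  [/\ pi (iota z x) = x, g_r SG (iota z x) = iota 1 x &
      g_s SG (iota z x) = iota 1 x].
Proof. by case: HS => [[_ _ [[h _ _ _] _] _ _] _]; exact: h. Qed.

Lemma iota_mul z w x : circle z -> circle w -> g_unit G x ->
  g_mul SG (iota z x) (iota w x) = iota (z * w) x.
Proof. by case: HS => [[_ _ [[_ h _ _] _] _ _] _]; exact: h. Qed.

Lemma iota_inj z w x y : circle z -> circle w -> g_unit G x -> g_unit G y ->
  iota z x = iota w y -> z = w /\ x = y.
Proof. by case: HS => [[_ _ [[_ _ h _] _] _ _] _]; exact: h. Qed.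

Lemma iota_onto sigma : g_unit G (pi sigma) ->
  exists z x, [/\ circle z, g_unit G x & sigma = iota z x].
Proof. by case: HS => [[_ _ [[_ _ _ h] _] _ _] _]; exact: h. Qed.

Lemma tw_act_trans sigma tau : pi sigma = pi tau ->
  exists z, circle z /\ tau = tw_act z sigma.
Proof. by case: HS => [[_ _ _ h _] _]; exact: h. Qed.

(** A unit lies over a unit, hence equals some [iota z x]. Being its own range, it is also
    [iota 1 x]. *)
Lemma twist_unit sigma : g_unit SG sigma -> sigma = iota 1 (pi sigma).
Proof.
move=> us; have up : g_unit G (pi sigma).
  by rewrite -(unit_r GS us) pi_r; exact: r_unit.
have [z [x [cz ux E]]] := iota_onto up.
have [E1 E2 E3] := iota_fib cz ux.
by rewrite -[LHS](unit_r GS us) E E2 E1.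
Qed.

Lemma twist_r sigma : g_r SG sigma = iota 1 (g_r G (pi sigma)).
Proof. by rewrite {1}(twist_unit (r_unit GS sigma)) pi_r. Qed.

Lemma twist_s sigma : g_s SG sigma = iota 1 (g_s G (pi sigma)).
Proof. by rewrite {1}(twist_unit (s_unit GS sigma)) pi_s. Qed.

Lemma twist_composable sigma tau : g_s G (pi sigma) = g_r G (pi tau) ->
  g_s SG sigma = g_r SG tau.
Proof. by rewrite twist_r twist_s => ->. Qed.

Lemma iota_composable z sigma : circle z ->
  g_s SG (iota z (g_r G (pi sigma))) = g_r SG sigma.
Proof.
by move=> cz; have [_ _ ->] := iota_fib cz (r_unit GG (pi sigma)); rewrite twist_r.
Qed.

Lemma pi_act z sigma : circle z -> pi (tw_act z sigma) = pi sigma.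
Proof.
move=> cz; rewrite /tw_act pi_mul ?iota_composable//.
by have [-> _ _] := iota_fib cz (r_unit GG (pi sigma)); rewrite mul_r.
Qed.

Lemma tw_act1 (sigma : Sg) : tw_act 1 sigma = sigma.
Proof. by rewrite /tw_act -twist_r mul_r//; exact: GS. Qed.

Lemma tw_actA z w sigma : circle z -> circle w ->
  tw_act z (tw_act w sigma) = tw_act (z * w) sigma.
Proof.
move=> cz cw; rewrite {1}/tw_act pi_act// /tw_act -(gmulA GS).
- by rewrite iota_mul//; exact: r_unit.
- have [_ _ ->] := iota_fib cz (r_unit GG (pi sigma)).
  by have [_ -> _] := iota_fib cw (r_unit GG (pi sigma)).
- by rewrite iota_composable.
Qed.

(** Cancelling [sigma] on the right reduces freeness of the action to injectivity of [iota]. *)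
Lemma tw_act_free z w sigma : circle z -> circle w ->
  tw_act z sigma = tw_act w sigma -> z = w.
Proof.
move=> cz cw E; have ur := r_unit GG (pi sigma).
have [] // := @iota_inj z w _ _ cz cw ur ur.
rewrite -(gmulK GS (iota_composable sigma cz)).
by rewrite -(gmulK GS (iota_composable sigma cw)); congr g_mul.
Qed.

(** A set-theoretic section of [pi] with no continuity, built by the same choice as in [at_lift] so
    that [at_lift] becomes evaluation at it. *)
Definition tw_lift (g : T) : Sg := proj1_sig (cid (pi_surj g)).

Lemma pi_tw_lift g : pi (tw_lift g) = g.
Proof. by rewrite /tw_lift; case: cid. Qed.

Lemma at_liftE (V : Type) (d : V) (F : Sg -> V) g : at_lift d F g = F (tw_lift g).
Proof.
rewrite /at_lift; case: pselect => [h|[]]; last exact: pi_surj.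
by rewrite /tw_lift (Prop_irrelevance h (pi_surj g)).
Qed.

Lemma equivariant_cabs (f : Sg -> Cx R) sigma tau : equivariant f ->
  pi sigma = pi tau -> cabs (f sigma) = cabs (f tau).
Proof.
move=> ef /tw_act_trans[z [cz ->]].
by rewrite ef// cabsM cz mul1r.
Qed.

Lemma osuppE (f : Sg -> Cx R) g : equivariant f ->
  osupp f g <-> cabs (f (tw_lift g)) != 0.
Proof.
move=> ef; split => [[sigma [sg]]|h].
  by rewrite -cabs_eq0 (@equivariant_cabs f sigma (tw_lift g))// pi_tw_lift.
by exists (tw_lift g); rewrite pi_tw_lift -cabs_eq0.
Qed.

(** Each [sigma] is a phase times the lift of [pi sigma], and freeness makes that phase unique,
    hence equivariant. This turns vectors indexed by arrows of [G] into test vectors for the regular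
    representation. *)
Lemma equivariant_extension (a : T -> Cx R) : exists xi : Sg -> Cx R,
  [/\ equivariant xi, (forall g, xi (tw_lift g) = a g) &
      forall sigma, a (pi sigma) = 0 -> xi sigma = 0].
Proof.
have phase sigma : exists z, circle z /\ sigma = tw_act z (tw_lift (pi sigma)).
  by apply: tw_act_trans; rewrite pi_tw_lift.
pose u sigma := proj1_sig (cid (phase sigma)).
have uP sigma : circle (u sigma) /\ sigma = tw_act (u sigma) (tw_lift (pi sigma)).
  by rewrite /u; case: cid.
exists (fun sigma => u sigma * a (pi sigma)); split=> [z sigma cz|g|sigma ->].
- rewrite pi_act// mulrA; congr (_ * _).
  have [c E] := uP sigma; have [c' E'] := uP (tw_act z sigma).
  apply: (@tw_act_free _ _ (tw_lift (pi sigma))) => //; first exact: circleM.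
  by rewrite -tw_actA// -E; rewrite pi_act// in E'.
- rewrite pi_tw_lift -[RHS]mul1r; congr (_ * _).
  have [c] := uP (tw_lift g); rewrite pi_tw_lift => E.
  by apply: (@tw_act_free _ _ (tw_lift g)) => //; [exact: circle1|rewrite tw_act1].
- by rewrite mulr0.
Qed.

(** The matrix entry of the left regular representation once every arrow carries its chosen lift. *)
Definition conv_kernel (f : Sg -> Cx R) (g h : T) : Cx R :=
  f (g_mul SG (tw_lift g) (g_inv SG (tw_lift h))).

Lemma pi_tw_lift_mulV g h : g_s G g = g_s G h ->
  pi (g_mul SG (tw_lift g) (g_inv SG (tw_lift h))) = g_mul G g (g_inv G h).
Proof.
move=> c; rewrite pi_mul ?pi_inv ?pi_tw_lift//.
by apply: twist_composable; rewrite pi_inv !pi_tw_lift (r_inv GG).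
Qed.

Lemma conv_kernel_cabs f g h : equivariant f -> g_s G g = g_s G h ->
  cabs (conv_kernel f g h) = cabs (f (tw_lift (g_mul G g (g_inv G h)))).
Proof. by move=> ef c; apply: equivariant_cabs => //; rewrite pi_tw_lift_mulV// pi_tw_lift. Qed.

End TwistAlgebra.

(** * The reduced norm *)

(** Compactness as induction over finite covers. The sets [A] with [P (K \ A)] form a filter; if
    [P K] failed it would be proper, and a cluster point in [K] would contradict the local
    hypothesis. *)
Lemma compact_ind (X : topologicalType) (P : set X -> Prop) (K : set X) :
  compact K -> P set0 -> (forall A B, P A -> P B -> P (A `|` B)) ->
  (forall A B, A `<=` B -> P B -> P A) ->
  (forall x, K x -> exists2 U, nbhs x U & P U) -> P K.
Proof.
move=> cK P0 PU PS PK; apply: contrapT => nPK.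
pose F : set_system X := fun A => P (K `\` A).
have FF : ProperFilter F.
  split; first by rewrite /F setD0.
  split; first by rewrite /F setDT.
  - by move=> A B FA FB; rewrite /F setDIr; exact: PU.
  - by move=> A B AB; apply: PS; exact: setDS.
have [|x [Kx]] := cK F FF; first by rewrite /F setDv.
have [U Ux PUU] := PK x Kx.
have FU : F (~` U) by apply: PS PUU => y [_] /contrapT.
by move=> /(_ _ _ FU Ux)[y []].
Qed.

Section Extended.
Context {R : realType}.

Lemma esqrt_le (x : \bar R) (r : R) : 0 <= r ->
  (esqrt x <= r%:E)%E = (x <= (r ^+ 2)%:E)%E.
Proof.
move=> r0; case: x => [x| |]//=; last by rewrite lee_fin r0 leNye.
rewrite !lee_fin; have [x0|x0] := leP 0 x.
  by rewrite -{1}(ger0_norm r0) -sqrtr_sqr ler_sqrt// sqr_ge0.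
by rewrite ltr0_sqrtr// r0 (le_trans (ltW x0))// sqr_ge0.
Qed.

(** From here on, sums over a fibre are handled only through duplicate-free lists. *)
Lemma esum_leP (X : choiceType) (A : set X) (u : X -> R) (b : R) :
  (\esum_(g in A) (u g)%:E <= b%:E)%E <->
  forall F : seq X, uniq F -> {in F, forall g, A g} -> \sum_(g <- F) u g <= b.
Proof.
split=> [h F uF FA|h].
  rewrite -lee_fin -sumEFin; apply: le_trans h; apply: ereal_sup_ubound.
  exists [set` F]; last by rewrite -fsbig_seq.
  by split; [exact: finite_seq|move=> g gF; exact: FA].
apply: ge_ereal_sup => _ [B [finB BA] <-].
rewrite fsbig_finite// sumEFin lee_fin; apply: h; first by [].
by move=> g; rewrite in_fset_set// inE => /BA.
Qed.

End Extended.

(** * Uniform finiteness of the fibres of compact sets *)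

Section Fibres.
Context {T : topologicalType} {G : groupoid T}.
Hypothesis HG : lch_etale_groupoid G.

Lemma etale_groupoid : is_groupoid G.
Proof. by case: HG => [[]]. Qed.
Local Notation GG := etale_groupoid.

(** The range map is locally injective, so every arrow has a neighbourhood meeting each range fibre
    at most once. The bounds add up over a finite cover. *)
Lemma compact_rfib_bound (K : set T) : compact K -> exists n,
  forall x F, uniq F -> {in F, forall g, K g /\ rfib G x g} -> (size F <= n)%N.
Proof.
move=> cK; pattern K; apply: (compact_ind cK).
- by exists 0%N => x [|g F]// _ /(_ g); rewrite inE eqxx => /(_ isT)[].
- move=> A B [n nA] [m mB]; exists (n + m)%N => x F uF h.
  rewrite -(count_predC (fun g => `[< A g >]) F) leq_add// -size_filter.
    apply: (nA x); first exact: filter_uniq.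
    by move=> g; rewrite mem_filter => /andP[/asboolP Ag] /h[].
  apply: (mB x); first exact: filter_uniq.
  move=> g; rewrite mem_filter /= => /andP[/asboolP Ag] /h[[]//].
- by move=> A B AB [n nB]; exists n => x F uF h; apply: (nB x) => // g /h[/AB].
move=> g _; have [_ [_ /(_ g)[U [oU Ug injU _]]] _ _] := HG.
exists U; first exact: open_nbhs_nbhs.
exists 1%N => x [|a [|b F]]// uF h.
have [] := h a; rewrite ?mem_head// => Ua ra.
have [] := h b; rewrite ?inE ?eqxx ?orbT// => Ub rb.
have ab : a = b by apply: injU => //; rewrite ra rb.
by move: uF; rewrite /= ab inE eqxx.
Qed.

(** Inversion is continuous and exchanges source and range fibres, so the source case is the range
    case for the inverse of [K]. *)
Lemma compact_fib_bound (K : set T) : compact K -> exists n,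
  forall x F, uniq F -> {in F, forall g, K g} ->
    {in F, forall g, sfib G x g} \/ {in F, forall g, rfib G x g} ->
    (size F <= n)%N.
Proof.
move=> cK; have [n nK] := compact_rfib_bound cK.
have ci : continuous (g_inv G) by case: HG => [[]].
have [|m mK] := @compact_rfib_bound (g_inv G @` K).
  by apply: continuous_compact => //; exact: continuous_subspaceT.
exists (maxn n m) => x F uF FK [Fs|Fr]; rewrite leq_max; last first.
  by rewrite (nK x)// => g gF; split; [exact: FK|exact: Fr].
rewrite -(size_map (g_inv G)) (mK x) ?orbT ?map_inj_uniq//.
  by apply: can_inj; exact: (ginvK GG).
move=> _ /mapP[g gF ->]; split; first by exists g => //; exact: FK.
by rewrite /rfib/= (r_inv GG); exact: Fs.
Qed.

End Fibres.

Lemma sum_uniq_sub {R : numDomainType} (I : eqType) (F E : seq I) (u : I -> R) :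
  uniq F -> uniq E -> (forall i, 0 <= u i) -> (forall i, i \notin E -> u i = 0) ->
  \sum_(i <- F) u i <= \sum_(i <- E) u i.
Proof.
move=> uF uE u0 uout.
rewrite (bigID (mem E))/= [X in _ + X]big1 ?addr0 => [|i]; last exact: uout.
rewrite [leRHS](bigID (mem F))/= -big_filter -[X in _ <= X + _]big_filter.
have -> : \sum_(i <- [seq i <- F | i \in E]) u i =
    \sum_(i <- [seq i <- E | i \in F]) u i.
  apply: perm_big; apply: uniq_perm; rewrite ?filter_uniq// => i.
  by rewrite !mem_filter andbC.
by rewrite lerDl sumr_ge0.
Qed.

(** * The reduced norm through finite matrices *)

Section ReducedNorm.
Context {R : realType} {T : topologicalType} {G : groupoid T} {S : twist R G}.
Hypotheses (HG : lch_etale_groupoid G) (HS : is_twist S).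
Local Notation Sg := (tw_sp S).
Local Notation pi := (tw_pi S).
Local Notation GG := (etale_groupoid HG).
Local Notation lift := (tw_lift HS).
Local Notation kernel := (conv_kernel HS).
Implicit Types (z w : Cx R) (sigma tau : Sg) (x g h : T) (f xi : Sg -> Cx R).

(* The left regular representation at [x] is the matrix [kernel f] once a lift
   of each arrow is fixed; its norm is the supremum over finite submatrices. *)
Definition conv_bounded f (r : R) : Prop :=
  forall x (F E : seq T) (a : T -> Cx R), g_unit G x -> uniq F -> uniq E ->
    {in F, forall g, sfib G x g} -> {in E, forall h, sfib G x h} ->
    \sum_(g <- F) cabs (\sum_(h <- E) kernel f g h * a h) ^+ 2 <=
    r ^+ 2 * \sum_(h <- E) cabs (a h) ^+ 2.

(** On a source fibre, the map sending [h] to the product of [g] and the inverse of [h] is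
    injective. It sends the support of the row into the range fibre of [g_r G g] inside a compact
    set, which is uniformly finite. *)
Lemma Cc_finite_row f x g : Cc f -> sfib G x g ->
  finite_set [set h | sfib G x h /\ kernel f g h != 0].
Proof.
move=> [_ ef cf] gx; have [n nK] := compact_rfib_bound HG cf.
apply: contrapT => /(@infinite_set_fset _ _ n.+1)[B Bsub].
rewrite ltnNge => /negP; apply.
rewrite -(size_map (fun h => g_mul G g (g_inv G h))) (nK (g_r G g))//.
  rewrite map_inj_in_uniq ?fset_uniq// => h h' /Bsub[hx _] /Bsub[h'x _].
  by apply: (gmulV_inj GG); rewrite gx ?hx ?h'x.
move=> _ /mapP[h /Bsub[hx fh] ->]; have gh : g_s G g = g_s G h by rewrite gx hx.
split; last by rewrite /rfib/= (r_mul GG)// (r_inv GG).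
apply: subset_closure; exists (g_mul (tw_gpd S) (lift g) (g_inv (tw_gpd S) (lift h))).
by split; first exact: (pi_tw_lift_mulV GG).
Qed.

(** The sum in [regrep] is a finitely supported one, so it may be taken over any finite list outside
    which the terms vanish. *)
Lemma regrep_lift f xi x g (E : seq T) : uniq E -> {in E, forall h, sfib G x h} ->
  (forall h, sfib G x h -> h \notin E -> kernel f g h * xi (lift h) = 0) ->
  regrep x f xi (lift g) = \sum_(h <- E) kernel f g h * xi (lift h).
Proof.
move=> uE Ex out; rewrite /regrep.
under eq_fsbigr do rewrite (at_liftE HS).
have sub : [set` E] `<=` sfib G x by move=> h /= /Ex.
rewrite (fsbigE E _ uE sub) => [|h hx hE]; last exact: out.
rewrite big_seq_cond [RHS]big_seq; apply: eq_bigl => h.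
by case: (boolP (h \in E)) => //= /Ex hx; rewrite mem_set.
Qed.

Lemma l2norm2_le x xi (b : R) : (l2norm2 x xi <= b%:E)%E <->
  forall F : seq T, uniq F -> {in F, forall g, sfib G x g} ->
    \sum_(g <- F) cabs (xi (lift g)) ^+ 2 <= b.
Proof.
rewrite /l2norm2; under eq_esum do rewrite (at_liftE HS).
exact: (esum_leP _ (fun g => cabs (xi (lift g)) ^+ 2)).
Qed.

Lemma rnorm_leP f (r : R) : Cc f -> 0 <= r ->
  (rnorm f <= r%:E)%E <-> conv_bounded f r.
Proof.
move=> Cf r0; rewrite /rnorm esqrt_le//; split; last first.
  move=> bf; apply: ge_ereal_sup => _ [x ux <-].
  apply: ge_ereal_sup => _ [xi [l2xi xi1] <-].
  apply/l2norm2_le => F uF Fx.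
  (* The rows indexed by [F] have finite supports, so only finitely many columns enter. *)
  have finE : finite_set (\bigcup_(g in [set` F]) [set h | sfib G x h /\ kernel f g h != 0]).
    by apply: bigcup_finite => [|g gF]; [exact: finite_seq|exact/Cc_finite_row/Fx].
  set E := fset_set (\bigcup_(g in [set` F]) [set h | sfib G x h /\ kernel f g h != 0]).
  have Ex : {in E, forall h, sfib G x h}.
    by move=> h; rewrite in_fset_set// => /set_mem[g _ []].
  have /l2norm2_le xiE := xi1.
  apply: (@le_trans _ _ (r ^+ 2 * \sum_(h <- E) cabs (xi (lift h)) ^+ 2)); last first.
    by rewrite ler_piMr ?sqr_ge0 ?xiE ?fset_uniq.
  apply: le_trans (bf x F E (fun h => xi (lift h)) ux uF (fset_uniq _) Fx Ex).
  rewrite big_seq [leRHS]big_seq; apply: ler_sum => g gF.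
  rewrite (@regrep_lift f xi x g E (fset_uniq _) Ex)// => h hx hE.
  have [->|k0] := eqVneq (kernel f g h) 0; first by rewrite mul0r.
  by case/negP: hE; rewrite in_fset_set// mem_set//; exists g.
move=> h x F E a ux uF uE Fx Ex.
set N := \sum_(h <- E) cabs (a h) ^+ 2.
have N0 : 0 <= N by apply: sumr_ge0 => *; exact: sqr_ge0.
have [/eqP|Nn] := eqVneq N 0.
  rewrite psumr_eq0; last by move=> *; exact: sqr_ge0.
  move=> /allP aE; rewrite big1 ?mulr_ge0 ?sqr_ge0// => g _.
  rewrite big_seq big1 ?cabs0 ?expr0n// => k /aE.
  by rewrite /= sqrf_eq0 cabs_eq0 => /eqP ->; rewrite mulr0.
have Ngt0 : 0 < N by rewrite lt_def Nn.
(* [opnorm2] tests vectors of norm at most 1 only, so [a] is normalised before it is extended to a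
   section. *)
pose c : R := (Num.sqrt N)^-1.
have c0 : 0 <= c by rewrite invr_ge0 sqrtr_ge0.
have c2 : c ^+ 2 = N^-1 by rewrite exprVn sqr_sqrtr.
have [xi [exi xil xi0]] := equivariant_extension GG HS
  (fun g => if g \in E then c%:C * a g else 0 : Cx R).
have xisupp g : g \notin E -> xi (lift g) = 0.
  by move=> /negbTE gE; rewrite xil gE.
have xi1 : (l2norm2 x xi <= 1)%E.
  apply/l2norm2_le => F' uF' _.
  apply: (@le_trans _ _ (\sum_(g <- E) cabs (xi (lift g)) ^+ 2)).
    by apply: sum_uniq_sub => // [k|k /xisupp ->]; rewrite ?sqr_ge0// cabs0 expr0n.
  rewrite (eq_big_seq (fun k => c ^+ 2 * cabs (a k) ^+ 2)) => [|k kE].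
    by rewrite -mulr_sumr c2 mulVf.
  by rewrite xil kE cabsM cabs_real// exprMn.
have l2xi : in_l2 x xi.
  split=> //; last by apply: le_lt_trans xi1 _; exact: ltry.
  by move=> sigma sx; apply: xi0; case: ifP => [/Ex/sx []|].

have : (l2norm2 x (regrep x f xi) <= (r ^+ 2)%:E)%E.
  apply: le_trans h; apply: le_trans (ereal_sup_ubound _); last by exists x.
  by apply: ereal_sup_ubound; exists xi; [split|exact: erefl].
move=> /l2norm2_le/(_ F uF Fx).
rewrite (eq_big_seq (fun g => c ^+ 2 * cabs (\sum_(h <- E) kernel f g h * a h) ^+ 2)).
  by rewrite -mulr_sumr c2 mulrC ler_pdivrMr.
move=> g gF; rewrite (@regrep_lift f xi x g E)// => [|k _ /xisupp ->]; last by rewrite mulr0.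
rewrite -exprMn -[X in X * _](cabs_real c0) -cabsM mulr_sumr; congr (cabs _ ^+ 2).
by apply: eq_big_seq => k kE; rewrite xil kE mulrCA.
Qed.

End ReducedNorm.

(** * Sums, multipliers and fibrewise 2-norms *)

Section NormInequalities.
Context {R : realType} {T : topologicalType} {G : groupoid T} {S : twist R G}.
Hypotheses (HG : lch_etale_groupoid G) (HS : is_twist S).
Local Notation Sg := (tw_sp S).
Local Notation pi := (tw_pi S).
Local Notation GG := (etale_groupoid HG).
Local Notation lift := (tw_lift HS).
Local Notation kernel := (conv_kernel HS).
Implicit Types (z w : Cx R) (sigma tau : Sg) (x g h : T) (f xi : Sg -> Cx R).

Lemma CcD f1 f2 : Cc f1 -> Cc f2 -> Cc (fun sigma => f1 sigma + f2 sigma).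
Proof.
move=> [c1 e1 k1] [c2 e2 k2]; split=> [sigma|z sigma cz|].
- exact: (@cvgD _ (Cx R) _ _ _ f1 f2 _ _ (c1 sigma) (c2 sigma)).
- by rewrite e1// e2// mulrDr.
apply: (subclosed_compact _ (compactU k1 k2)); first exact: closed_closure.
rewrite -closureU; apply: closureS => g [sigma [sg fs]].
have [f10|f1n] := eqVneq (f1 sigma) 0; last by left; exists sigma.
by right; exists sigma; split=> //; rewrite f10 add0r in fs.
Qed.

Lemma Cc_mul (u : Sg -> R) f : continuous u ->
  (forall z sigma, circle z -> u (tw_act z sigma) = u sigma) ->
  Cc f -> Cc (fun sigma => (u sigma)%:C * f sigma).
Proof.
move=> cu eu [cf ef kf]; split=> [sigma|z sigma cz|].
- exact: (cvgM (f := fun s => (u s)%:C) (g := f) (continuous_realC cu (x:=sigma)) (cf sigma)).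
- by rewrite ef// eu// mulrCA.
apply: (subclosed_compact _ kf); first exact: closed_closure.
apply: closureS => g [sigma [sg]]; rewrite mulf_eq0 negb_or => /andP[_ fs].
by exists sigma.
Qed.

Lemma CcN f : Cc f -> Cc (fun sigma => - f sigma).
Proof.
move=> Cf; have := @Cc_mul (fun=> -1) f (@cst_continuous _ _ _) (fun _ _ _ => erefl) Cf.
by congr Cc; apply/funext => sigma; rewrite rmorphN/= mulN1r.
Qed.

Lemma CcB f1 f2 : Cc f1 -> Cc f2 -> Cc (fun sigma => f1 sigma - f2 sigma).
Proof. by move=> C1 C2; apply: CcD => //; exact: CcN. Qed.

(* The constant 2 comes from using [(u + v)^2 <= 2 (u^2 + v^2)] instead of
   Minkowski's inequality. *)
Lemma rnorm_add f1 f2 (r1 r2 : R) : Cc f1 -> Cc f2 -> 0 <= r1 -> 0 <= r2 ->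
  (rnorm f1 <= r1%:E)%E -> (rnorm f2 <= r2%:E)%E ->
  (rnorm (fun sigma => f1 sigma + f2 sigma)%R <= (2 * (r1 + r2))%:E)%E.
Proof.
move=> C1 C2 r10 r20 /(rnorm_leP HG HS C1 r10) b1 /(rnorm_leP HG HS C2 r20) b2.
have C12 := CcD C1 C2.
have r0 : 0 <= 2 * (r1 + r2) by rewrite mulr_ge0// addr_ge0.
apply/(rnorm_leP HG HS C12 r0) => x F E a ux uF uE Fx Ex.
have {}b1 := b1 x F E a ux uF uE Fx Ex; have {}b2 := b2 x F E a ux uF uE Fx Ex.
set N := \sum_(h <- E) _ in b1 b2 *.
have N0 : 0 <= N by apply: sumr_ge0 => *; exact: sqr_ge0.
apply: (@le_trans _ _ (2 * (r1 ^+ 2 * N + r2 ^+ 2 * N))); last first.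
  rewrite -mulrDl mulrA ler_wpM2r//; nra.
apply: le_trans (ler_wpM2l (ler0n _ 2) (lerD b1 b2)).
rewrite -big_split mulr_sumr; apply: ler_sum => g _ /=.
apply: le_trans (sqr_cabsD _ _); rewrite -big_split/= ler_sqr ?nnegrE ?cabs_ge0//.
rewrite le_eqVlt; apply/orP; left; apply/eqP; congr cabs.
by apply: eq_bigr => h _; rewrite /conv_kernel mulrDl.
Qed.

(* Writing [phi (g h^-1)] as [sum_l w l g * w l h] with [sum_l (w l g) ^ 2 = 1],
   the multiplied matrix applied to [a] is a combination, with coefficients
   [w l g], of the original matrix applied to the vectors [w l * a]. *)
Lemma rnorm_schur (phi : T -> R) f (r : R) :
  continuous phi ->
  (forall x n (gam : 'I_n -> T), g_unit G x -> (forall i, sfib G x (gam i)) ->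
    pos_kernel (fun i j => phi (g_mul G (gam i) (g_inv G (gam j))))) ->
  (forall x, g_unit G x -> phi x = 1) ->
  Cc f -> 0 <= r -> (rnorm f <= r%:E)%E ->
  (rnorm (fun sigma => ((phi (pi sigma))%:C * f sigma)%R) <= r%:E)%E.
Proof.
move=> cphi pphi phi1 Cf r0 /(rnorm_leP HG HS Cf r0) bf.
have C' : Cc (fun sigma => (phi (pi sigma))%:C * f sigma).
  apply: Cc_mul => // [sigma|z sigma cz]; last by rewrite (pi_act GG HS).
  by apply: continuous_comp; [exact: pi_continuous|exact: cphi].
apply/(rnorm_leP HG HS C' r0) => x F E a ux uF uE Fx Ex.
(* The Gram decomposition must serve rows and columns at once, so it is taken on the union of both
   index lists. *)
pose s := undup (F ++ E).
have sx i : (i < size s)%N -> sfib G x (nth x s i).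
  move=> /(mem_nth x); rewrite mem_undup mem_cat => /orP[/Fx//|/Ex//].
have sF g : g \in F -> (index g s < size s)%N.
  by move=> gF; rewrite index_mem mem_undup mem_cat gF.
have sE g : g \in E -> (index g s < size s)%N.
  by move=> gF; rewrite index_mem mem_undup mem_cat gF orbT.
have [m [v vE]] := pos_kernel_gram (pphi x (size s) (fun i => nth x s i) ux
  (fun i => sx i (ltn_ord i))).
pose w l g : R := if insub (index g s) is Some i then v l i else 0.
have wE g h : (index g s < size s)%N -> (index h s < size s)%N ->
    phi (g_mul G g (g_inv G h)) = \sum_(l < m) w l g * w l h.
  move=> gs hs; have := vE (Ordinal gs) (Ordinal hs).
  rewrite /= !nth_index -?index_mem// => ->.
  by apply: eq_bigr => l _; rewrite /w !insubT.
(* The diagonal value of the kernel is [phi] at a unit, which is 1. *)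
have w1 g : (index g s < size s)%N -> \sum_(l < m) w l g ^+ 2 = 1.
  move=> gs; under eq_bigr do rewrite expr2.
  rewrite -wE// (gmulgV GG) phi1//; exact: (r_unit GG).
apply: (@le_trans _ _ (\sum_(g <- F) \sum_(l < m)
    cabs (\sum_(h <- E) kernel f g h * ((w l h)%:C * a h)) ^+ 2)).
  rewrite big_seq [leRHS]big_seq; apply: ler_sum => g gF.
  rewrite -[leRHS]mul1r -(w1 g (sF g gF)).
  apply: le_trans (cabs_sum_sqr _ _).
  rewrite le_eqVlt; apply/orP; left; apply/eqP; congr (cabs _ ^+ 2).
  under [RHS]eq_bigr do rewrite mulr_sumr.
  rewrite exchange_big/=; apply: eq_big_seq => h hE.
  rewrite {1}/conv_kernel (pi_tw_lift_mulV GG); last by rewrite (Fx g gF) (Ex h hE).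
  rewrite (wE _ _ (sF g gF) (sE h hE)) rmorph_sum/= !mulr_suml; apply: eq_bigr => l _.
  rewrite rmorphM/= /conv_kernel; ring.
rewrite exchange_big/=.
apply: (@le_trans _ _ (\sum_(l < m) r ^+ 2 * \sum_(h <- E) cabs ((w l h)%:C * a h) ^+ 2)).
  by apply: ler_sum => l _; exact: (bf x F E (fun h => (w l h)%:C * a h)).
rewrite -mulr_sumr ler_wpM2l ?sqr_ge0// exchange_big/= le_eqVlt; apply/orP; left; apply/eqP.
apply: eq_big_seq => h hE; under eq_bigr do rewrite cabsM exprMn.
rewrite -mulr_suml -[RHS]mul1r; congr (_ * _); rewrite -(w1 h (sE h hE)).
by apply: eq_bigr => l _; rewrite /cabs/= expr0n/= addr0 sqr_sqrtr// sqr_ge0.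
Qed.

(** Testing the matrix on the basis vector at the unit [x] reads off the values of [f] on the source
    fibre, up to phases. *)
Lemma rnorm_ge_sfib f (r : R) x F : Cc f -> 0 <= r -> (rnorm f <= r%:E)%E ->
  g_unit G x -> uniq F -> {in F, forall g, sfib G x g} ->
  \sum_(g <- F) cabs (f (lift g)) ^+ 2 <= r ^+ 2.
Proof.
move=> Cf r0 /(rnorm_leP HG HS Cf r0) bf ux uF Fx; have [_ ef _] := Cf.
have xx : {in [:: x], forall h, sfib G x h}.
  by move=> h; rewrite inE => /eqP ->; exact: (unit_s GG).
have := bf x F [:: x] (fun=> 1) ux uF isT Fx xx.
have c1 := @circle1 R; rewrite /circle in c1.
rewrite big_seq1 c1 expr1n mulr1; apply: le_trans.
rewrite big_seq [leRHS]big_seq; apply: ler_sum => g gF.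
rewrite big_seq1 mulr1 (conv_kernel_cabs GG)//; last by rewrite (Fx g gF) (unit_s GG).
by rewrite (ginv_unit GG)// (gmul_unit GG)//; exact: Fx.
Qed.

(* The row at the unit [x] is tested against its own complex conjugate. *)
Lemma rnorm_ge_rfib f (r : R) x F : Cc f -> 0 <= r -> (rnorm f <= r%:E)%E ->
  g_unit G x -> uniq F -> {in F, forall g, rfib G x g} ->
  \sum_(g <- F) cabs (f (lift g)) ^+ 2 <= r ^+ 2.
Proof.
move=> Cf r0 /(rnorm_leP HG HS Cf r0) bf ux uF Fx; have [_ ef _] := Cf.
have sx : g_s G x = x by exact: (unit_s GG).
have xx : {in [:: x], forall h, sfib G x h}.
  by move=> h; rewrite inE => /eqP ->.
have iF : {in map (g_inv G) F, forall h, sfib G x h}.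
  by move=> _ /mapP[g gF ->]; rewrite /sfib/= (s_inv GG); exact: Fx.
have uiF : uniq (map (g_inv G) F).
  by rewrite map_inj_uniq//; apply: can_inj; exact: (ginvK GG).
have := bf x [:: x] _ (fun h => (kernel f x h)^*%C) ux isT uiF xx iF.
rewrite big_seq1; under eq_bigr do rewrite mul_conj; under [in leRHS]eq_bigr do rewrite cabs_conj.
set N := \sum_(h <- map _ F) cabs _ ^+ 2; rewrite -raddf_sum/= -/N.
have N0 : 0 <= N by apply: sumr_ge0 => *; exact: sqr_ge0.
rewrite cabs_real// => NN.
have -> : \sum_(g <- F) cabs (f (lift g)) ^+ 2 = N.
  rewrite /N big_map; apply: eq_big_seq => g gF.
  have rg : g_r G g = x := Fx g gF.
  rewrite (conv_kernel_cabs GG)//; last by rewrite sx (s_inv GG).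
  by rewrite (ginvK GG) -rg (mul_r GG).
(* The test gave [N ^+ 2 <= r ^+ 2 * N]; dividing by [N] needs [N] nonzero. *)
have [->|Nn] := eqVneq N 0; first exact: sqr_ge0.
by rewrite -(@ler_pM2r _ N) ?lt_def ?Nn// -expr2.
Qed.

Lemma norm2pL_le (L : T -> R) (p : nat) f (b : R) : 0 <= b ->
  (forall x F, g_unit G x -> uniq F ->
     {in F, forall g, sfib G x g} \/ {in F, forall g, rfib G x g} ->
     \sum_(g <- F) cabs (f (lift g)) ^+ 2 * (1 + L g) ^+ (2 * p) <= b ^+ 2) ->
  (norm2pL L p f <= b%:E)%E.
Proof.
move=> b0 h; rewrite /norm2pL ge_max !esqrt_le//; apply/andP; split.
- apply: ge_ereal_sup => _ [x ux <-].
  under eq_esum do rewrite (at_liftE HS).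
  apply/(esum_leP _ (fun g => cabs (f (lift g)) ^+ 2 * (1 + L g) ^+ (2 * p))).
  by move=> F uF Fx; apply: (h x) => //; left.
- apply: ge_ereal_sup => _ [x ux <-].
  under eq_esum do rewrite (at_liftE HS).
  apply/(esum_leP _ (fun g => cabs (f (lift g)) ^+ 2 * (1 + L g) ^+ (2 * p))).
  by move=> F uF Fx; apply: (h x) => //; right.
Qed.

End NormInequalities.

(** * Rapid decay and negative type *)

Lemma compact_bounded_above {R : realType} (X : topologicalType) (K : set X) (D : X -> R) :
  compact K -> continuous D -> exists B, 0 <= B /\ forall x, K x -> D x <= B.
Proof.
move=> cK cD.
have /compact_bounded[M [_ hM]] : compact (D @` K : set R^o).
  by apply: continuous_compact => //; exact: continuous_subspaceT.
exists (`|M| + 1); split=> [|x Kx]; first by rewrite addr_ge0.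
apply: le_trans (ler_norm _) _; apply: hM; last by exists x.
by rewrite (le_lt_trans (ler_norm M))// ltrDl.
Qed.

(* [(1 + sqrt y)^2 <= 2 (1 + y)], and [1 + y] is bounded by a multiple of
   [exp (t y / (p + 1))]. *)
Lemma expR_decay {R : realType} (t : R) (p : nat) : 0 < t ->
  exists C, 0 <= C /\ forall y, 0 <= y ->
    expR (- t * y) ^+ 2 * (1 + Num.sqrt y) ^+ (2 * p) <= C ^+ 2.
Proof.
(* The exponent satisfies [q * p <= t], so the [p]-th power of [expR (q * y)] costs only one of the
   two factors [expR (- t * y)]. Dividing by [p.+1] also covers [p = 0]. *)
move=> t0; pose q : R := t / p.+1%:R.
have q0 : 0 < q by rewrite divr_gt0.
pose A : R := 2 * (1 + q^-1).
have A1 : 1 <= A by rewrite /A; have := invr_gt0 q; rewrite q0 => h; lra.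
have A0 : 0 <= A by apply: le_trans A1.
exists (A ^+ p); split=> [|y y0]; first exact: exprn_ge0.
set e := expR (- t * y).
have e0 : 0 < e := expR_gt0 _.
have e1 : e <= 1 by rewrite -expR0 ler_expR mulNr oppr_le0 mulr_ge0// ltW.
have E2 : (1 + Num.sqrt y) ^+ 2 <= A * expR (q * y).
  have := sqr_sqrtr y0; have := sqrtr_ge0 y; move: (Num.sqrt y) => z z0 zz.
  have : 1 + q * y <= expR (q * y) := expR_ge1Dx _.
  have : (1 + z) ^+ 2 <= A * (1 + q * y).
    have -> : A * (1 + q * y) = 2 * (1 + q^-1 + q * y + y).
      by rewrite /A; field; lra.
    have := invr_gt0 q; rewrite q0 => h.
    have := mulr_ge0 (ltW q0) y0 => h2.
    by have := sqr_ge0 (z - 1); rewrite -zz in h2 *; nra.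
  by move=> h1 h2; apply: le_trans h1 _; rewrite ler_wpM2l.
have E3 : (1 + Num.sqrt y) ^+ (2 * p) <= A ^+ p * expR (q * y) ^+ p.
  by rewrite exprM -exprMn; apply: lerXn2r E2; rewrite nnegrE ?sqr_ge0// mulr_ge0// expR_ge0.
have E4 : expR (q * y) ^+ p <= e^-1.
  rewrite -expRM_natl -expRN ler_expR mulNr opprK mulrA ler_wpM2r//.
  rewrite /q mulrCA ler_piMr ?(ltW t0)//.
  by rewrite ler_pdivrMr ?ltr0n// mul1r ler_nat.
have E5 : e ^+ 2 * (A ^+ p * expR (q * y) ^+ p) <= A ^+ p * e.
  rewrite mulrCA ler_wpM2l ?exprn_ge0// -ler_pdivlMl ?exprn_gt0//.
  by apply: le_trans E4 _; rewrite expr2 invfM -mulrA mulVf ?mulr1// gt_eqF.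
apply: le_trans (ler_wpM2l _ E3) _; first exact: sqr_ge0.
apply: le_trans E5 _; apply: le_trans (ler_piMr _ e1) _; first exact: exprn_ge0.
by rewrite expr2 ler_peMr ?exprn_ge0// exprn_ege1.
Qed.

(** * Positive kernels from a function of negative type *)

Section NegativeType.
Context {R : realType} {T : topologicalType} {G : groupoid T} {psi : T -> R}.
Hypotheses (GG : is_groupoid G) (Hpsi : loc_proper_neg_type G psi).
Implicit Types (x g h : T).

(** The unit [x] is added to the family with weight [- \sum_i c i], so that the weights sum to zero.
    Since [psi] vanishes on units and is symmetric, conditional negativity of the larger family is
    positivity of this kernel. *)
Lemma neg_type_kernel x n (gam : 'I_n -> T) : g_unit G x ->
  (forall i, sfib G x (gam i)) ->
  pos_kernel (fun i j => psi (gam i) + psi (gam j) -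
    psi (g_mul G (gam i) (g_inv G (gam j)))).
Proof.
case: Hpsi => _ psi0 psiV cnd _ ux gx; split=> [i j|c].
  rewrite [psi (gam j) + _]addrC; congr (_ - _).
  by rewrite -psiV (ginvM GG) ?(ginvK GG)// (r_inv GG) (gx i) (gx j).
pose gam' i := if unlift ord0 i is Some k then gam k else x.
pose lam' i := if unlift ord0 i is Some k then c k else - \sum_i c i.
have := cnd x n.+1 gam' lam' ux.
have lift_gam k : gam' (fintype.lift ord0 k) = gam k by rewrite /gam' liftK.
have lift_lam k : lam' (fintype.lift ord0 k) = c k by rewrite /lam' liftK.
have g0 : gam' ord0 = x by rewrite /gam' unlift_none.
have l0 : lam' ord0 = - \sum_i c i by rewrite /lam' unlift_none.
have gx' i : g_s G (gam' i) = x.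
  by rewrite /gam'; case: unlift => [k|]; [exact: gx|exact: (unit_s GG)].
have lsum : \sum_i lam' i = 0.
  rewrite big_ord_recl l0; under [X in _ + X]eq_bigr do rewrite lift_lam.
  by rewrite addNr.
move=> /(_ gx' lsum).
have rx j : g_mul G x (g_inv G (gam j)) = g_inv G (gam j).
  by rewrite -{1}(gx j) -(r_inv GG) (mul_r GG).
have sx i : g_mul G (gam i) (g_inv G x) = gam i.
  by rewrite (ginv_unit GG)// (gmul_unit GG)//; exact: gx.
set s := \sum_i c i in l0.
set b := \sum_j c j * psi (gam j).
set a := \sum_i \sum_j c i * c j * psi (g_mul G (gam i) (g_inv G (gam j))).
have row0 : \sum_j lam' ord0 * lam' j * psi (g_mul G (gam' ord0) (g_inv G (gam' j))) = - s * b.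
  rewrite big_ord_recl g0 l0 (gmulgV GG) psi0; last exact: (r_unit GG).
  rewrite mulr0 add0r mulr_sumr; apply: eq_bigr => j _.
  by rewrite lift_lam lift_gam rx psiV mulrA.
have row i : \sum_j lam' (fintype.lift ord0 i) * lam' j *
      psi (g_mul G (gam' (fintype.lift ord0 i)) (g_inv G (gam' j))) =
    - s * (c i * psi (gam i)) + \sum_j c i * c j * psi (g_mul G (gam i) (g_inv G (gam j))).
  rewrite big_ord_recl g0 l0 lift_lam lift_gam sx; congr (_ + _); first by ring.
  by apply: eq_bigr => j _; rewrite lift_lam lift_gam.
rewrite big_ord_recl row0 (eq_bigr _ (fun i _ => row i)) big_split/= -mulr_sumr -/a -/b => h.
suff -> : quad_form (fun i j => psi (gam i) + psi (gam j) -
    psi (g_mul G (gam i) (g_inv G (gam j)))) c = 2 * (s * b) - a by lra.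
rewrite /quad_form /a.
have -> : 2 * (s * b) = b * s + s * b by ring.
rewrite {1}/b mulr_suml {2}/s mulr_suml -big_split -sumrB; apply: eq_bigr => i _ /=.
rewrite {1}/s /b !mulr_sumr -big_split -sumrB; apply: eq_bigr => j _ /=; ring.
Qed.

(** For the one-point family [g], the diagonal entry of the positive kernel above is [2 * psi g]. *)
Lemma neg_type_ge0 g : 0 <= psi g.
Proof.
have sg : forall i : 'I_1, sfib G (g_s G g) g by [].
have := pos_kernel_diag_ge0 ord0 (neg_type_kernel (s_unit GG g) sg).
have [_ psi0 _ _ _] := Hpsi.
by rewrite (gmulgV GG) (psi0 _ (r_unit GG g)); lra.
Qed.

Definition heat (t : R) (g : T) : R := expR (- t * psi g).

Lemma continuous_heat t : continuous (heat t).
Proof.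
case: Hpsi => cpsi _ _ _ _ g; apply: (continuous_comp (f := fun g => - t * psi g) (g := expR)).
  by apply: cvgMl_tmp; exact: cpsi.
exact: continuous_expR.
Qed.

Lemma heat_ge0 t g : 0 <= heat t g. Proof. exact: expR_ge0. Qed.

Lemma heat_unit t x : g_unit G x -> heat t x = 1.
Proof. by case: Hpsi => _ psi0 _ _ _ ux; rewrite /heat psi0// mulr0 expR0. Qed.

Lemma heat_le1 t g : 0 <= t -> heat t g <= 1.
Proof. by move=> t0; rewrite -expR0 ler_expR mulNr oppr_le0 mulr_ge0 ?neg_type_ge0. Qed.

Lemma heat_kernel t x n (gam : 'I_n -> T) : 0 <= t -> g_unit G x ->
  (forall i, sfib G x (gam i)) ->
  pos_kernel (fun i j => heat t (g_mul G (gam i) (g_inv G (gam j)))).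
Proof.
move=> t0 ux gx.
exact: (pos_kernel_schoenberg (a := fun i => psi (gam i)) t0 (neg_type_kernel ux gx)).
Qed.

End NegativeType.

(** * Approximation by multipliers and truncation *)

Section Approximation.
Context {R : realType} {T : topologicalType} {G : groupoid T} {S : twist R G}.
Context {psi : T -> R}.
Hypotheses (HG : lch_etale_groupoid G) (HS : is_twist S).
Hypothesis Hpsi : loc_proper_neg_type G psi.
Local Notation Sg := (tw_sp S).
Local Notation pi := (tw_pi S).
Local Notation GG := (etale_groupoid HG).
Local Notation lift := (tw_lift HS).
Local Notation L := (fun g => Num.sqrt (psi g)).
Implicit Types (z w : Cx R) (sigma tau : Sg) (x g h : T) (f xi : Sg -> Cx R).

(** The lift need not be continuous, but the modulus of [f] is constant on the fibres of [pi] and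
    descends along this open map. *)
Lemma continuous_cabs_lift f : Cc f -> continuous (fun g => cabs (f (lift g))).
Proof.
move=> [cf ef _] g; apply/cvgrPdist_lt => e e0.
have /cvgrPdist_lt/(_ e e0) := @continuous_cabs _ _ _ cf (lift g).
rewrite -[X in X -> _]/(nbhs _ _) nbhsE => -[V [oV Vg] Ve].
have : nbhs g (pi @` V).
  apply: open_nbhs_nbhs; split; first exact: (pi_open HS).
  by exists (lift g) => //; exact: pi_tw_lift.
apply: filterS => _ [sigma Vs <-].
rewrite (@equivariant_cabs _ _ _ _ HS f (lift (pi sigma)) sigma)//; first exact: Ve.
exact: pi_tw_lift.
Qed.

Lemma Cc_heat t f : Cc f -> Cc (fun sigma => (heat (psi := psi) t (pi sigma))%:C * f sigma).
Proof.
apply: Cc_mul => // [sigma|z sigma cz]; last by rewrite (pi_act GG HS).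
by apply: continuous_comp; [exact: pi_continuous|exact: (continuous_heat Hpsi)].
Qed.

Lemma osupp_lift f g : Cc f -> ~ closure (osupp f) g -> cabs (f (lift g)) = 0.
Proof.
move=> [_ ef _] ng; apply/eqP/negPn/negP => fg; apply: ng; apply: subset_closure.
exact/(osuppE HS g ef).
Qed.

Section RapidDecay.
Variables (c : R) (p : nat).
Hypotheses (c0 : 0 < c)
  (RD : forall f, Cc f -> (rnorm f <= c%:E * norm2pL L p f)%E).

Lemma rnorm_rapid_decay f (b : R) : Cc f -> 0 <= b ->
  (forall x F, g_unit G x -> uniq F ->
     {in F, forall g, sfib G x g} \/ {in F, forall g, rfib G x g} ->
     \sum_(g <- F) cabs (f (lift g)) ^+ 2 * (1 + L g) ^+ (2 * p) <= b ^+ 2) ->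
  (rnorm f <= (c * b)%:E)%E.
Proof.
move=> Cf b0 h; apply: le_trans (RD Cf) _.
rewrite EFinM; apply: lee_wpmul2l; first by rewrite lee_fin ltW.
exact: norm2pL_le h.
Qed.

(** On the compact closed support, [1 - heat t] is at most [t * psi], and the fibres there are
    uniformly finite. The weighted 2-norm of the difference is therefore of order [t], and rapid
    decay applies. *)
Lemma rnorm_heat_approx f (e : R) : Cc f -> 0 < e -> exists t, 0 < t /\
  (rnorm (fun sigma => (f sigma - (heat (psi := psi) t (pi sigma))%:C * f sigma)%R) <= e%:E)%E.
Proof.
move=> Cf e0; have [cf ef kf] := Cf.
have [n nK] := compact_fib_bound HG kf.
have cpsi : continuous psi by case: Hpsi.
have [B1 [B10 B1P]] := compact_bounded_above kf cpsi.
have [B2 [B20 B2P]] := compact_bounded_above kf (continuous_cabs_lift Cf).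
(* On the closed support, [D] bounds the product of [psi], the modulus of [f] and the weight. *)
pose D := (B1 * B2) * (1 + Num.sqrt B1) ^+ p.
have s0 : 0 <= 1 + Num.sqrt B1 by rewrite addr_ge0// sqrtr_ge0.
have D0 : 0 <= D by rewrite !mulr_ge0// exprn_ge0.
have N0 : 0 < c * ((n%:R + 1) * D + 1).
  by rewrite mulr_gt0// ltr_wpDl// mulr_ge0// addr_ge0.
exists (e / (c * ((n%:R + 1) * D + 1))); split; first exact: divr_gt0.
set t := e / _; have t0 : 0 < t by exact: divr_gt0.
apply: (@le_trans _ _ (c * ((n%:R + 1) * (t * D)))%:E); last first.
  rewrite lee_fin [X in X <= _](_ : _ = e * (c * ((n%:R + 1) * D) / (c * ((n%:R + 1) * D + 1)))).
    rewrite ler_piMr ?(ltW e0)// ler_pdivrMr// mul1r ler_wpM2l ?(ltW c0)//; lra.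
  by rewrite /t; ring.
apply: rnorm_rapid_decay.
- exact/(CcB Cf)/Cc_heat.
- by rewrite mulr_ge0 ?addr_ge0// mulr_ge0// ltW.
move=> x F ux uF Fx.
apply: (@le_trans _ _ (\sum_(g <- F) if `[< closure (osupp f) g >] then (t * D) ^+ 2 else 0)).
  apply: ler_sum => g _.
  rewrite pi_tw_lift -{1}[f (lift g)]mul1r -mulrBl.
  case: asboolP => [Kg|/(osupp_lift Cf)]; last by rewrite cabsM => ->; rewrite mulr0 expr0n/= mul0r.
  have p0 := neg_type_ge0 GG Hpsi g.
  have h1 := heat_le1 GG Hpsi g (ltW t0).
  rewrite -[1 - _]rmorphB/= cabsM cabs_real ?subr_ge0//.
  have h2 : 1 - heat (psi := psi) t g <= t * B1.
    have : 1 + - t * psi g <= heat (psi := psi) t g := expR_ge1Dx _.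
    have := ler_wpM2l (ltW t0) (B1P g Kg); lra.
  have h3 : (1 + Num.sqrt (psi g)) ^+ p <= (1 + Num.sqrt B1) ^+ p.
    by apply: lerXn2r; rewrite ?nnegrE ?addr_ge0 ?sqrtr_ge0// lerD2l ler_wsqrtr// B1P.
  rewrite [(2 * p)%N]mulnC exprM -exprMn; apply: lerXn2r.
  - by rewrite nnegrE !mulr_ge0 ?subr_ge0 ?cabs_ge0 ?exprn_ge0 ?addr_ge0 ?sqrtr_ge0.
  - by rewrite nnegrE mulr_ge0// ltW.
  rewrite /D mulrA; apply: ler_pM => //; rewrite ?exprn_ge0 ?addr_ge0 ?sqrtr_ge0//.
    by rewrite mulr_ge0 ?subr_ge0 ?cabs_ge0.
  rewrite mulrA; apply: ler_pM; rewrite ?subr_ge0 ?cabs_ge0//; exact: B2P.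
rewrite -big_mkcond/= -big_filter big_const_seq count_predT iter_addr_0 -[leLHS]mulr_natl.
rewrite [leRHS]exprMn ler_wpM2r ?sqr_ge0//.
apply: (@le_trans _ _ n%:R).
  rewrite ler_nat; apply: (nK x); first exact: filter_uniq.
    by move=> g; rewrite mem_filter => /andP[/asboolP].
  by case: Fx => Fx; [left|right] => g; rewrite mem_filter => /andP[_ /Fx].
(* The factor [n + 1] replaces the square root of [n], through [n <= (n + 1) ^ 2]. *)
by have := ler0n R n; move: (n%:R) => y; nra.
Qed.

(** For [d > 0], a continuous ramp in [s]: it is 0 up to [d], linear between [d] and [2 * d], and 1
    beyond. *)
Definition cutoff (d s : R) : R := Num.max 0 (Num.min 1 (s / d - 1)).

Lemma continuous_cutoff d : continuous (cutoff d).
Proof.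
move=> s; have cst (k : R) : {for s, continuous (fun _ : R => k : R^o)} by exact: cst_continuous.
have lin : {for s, continuous (fun r : R => r / d - 1 : R^o)}.
  by apply: cvgB; [apply: cvgMr_tmp; exact: cvg_id|exact: cvg_cst].
exact: (continuous_max (cst 0) (continuous_min (cst 1) lin)).
Qed.

Lemma cutoff_ge0 d s : 0 <= cutoff d s.
Proof. by rewrite le_max lexx. Qed.

Lemma cutoff_le1 d s : cutoff d s <= 1.
Proof. by rewrite ge_max ler01 ge_min lexx. Qed.

Lemma cutoff_eq0 d s : 0 < d -> s < d -> cutoff d s = 0.
Proof.
move=> d0 sd; apply/max_idPl; rewrite ge_min; apply/orP; right.
by rewrite subr_le0 ler_pdivrMr// mul1r ltW.
Qed.

Lemma cutoff_eq1 d s : 0 < d -> 2 * d <= s -> cutoff d s = 1.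
Proof.
move=> d0 sd; rewrite /cutoff (min_idPl _) ?(max_idPr _)//.
by rewrite lerBrDr ler_pdivlMr//; lra.
Qed.

(** The cutoff reads the height of [f] itself, not of its product with [heat], so the threshold [d]
    can be compared with a uniform distance from [f] whatever [t] is. Depending on the modulus only,
    it preserves equivariance. *)
Definition truncation t d f sigma : Cx R :=
  (heat (psi := psi) t (pi sigma) * cutoff d (cabs (f sigma)))%:C * f sigma.

Lemma Cc_truncation t d f : Cc f -> Cc (truncation t d f).
Proof.
move=> Cf; have [cf ef _] := Cf; apply: Cc_mul => // [sigma|z sigma cz]; last first.
  by rewrite (pi_act GG HS)// ef// cabsM cz mul1r.
apply: cvgM.
  by apply: continuous_comp; [exact: pi_continuous|exact: (continuous_heat Hpsi)].
apply: (continuous_comp (f := fun sigma => cabs (f sigma)) (g := cutoff d)).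
  exact: continuous_cabs.
exact: continuous_cutoff.
Qed.

(** The arrows where [f] has modulus at least [d] form a closed set containing the open support of
    the truncation. *)
Lemma closure_osupp_truncation t d f g : Cc f -> 0 < d ->
  closure (osupp (truncation t d f)) g -> d <= cabs (f (lift g)).
Proof.
move=> Cf d0; have cl : closed [set g | d <= cabs (f (lift g))].
  apply: (@closed_comp _ _ (fun g => cabs (f (lift g))) [set s | d <= s]).
    by move=> ? _; exact: continuous_cabs_lift.
  exact: closed_ge.
move=> cg; apply: cl; move: g cg; apply: closureS => _ [sigma [<- fs]] /=.
have [_ ef _] := Cf.
rewrite (@equivariant_cabs _ _ _ _ HS f (lift (pi sigma)) sigma)//; last exact: pi_tw_lift.
rewrite leNgt; apply/negP => h; move: fs.
by rewrite /truncation cutoff_eq0// mulr0 mul0r eqxx.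
Qed.

(* Where [f] and its truncation differ, either [|f| <= 2 d], on the support of
   [f'] whose fibres have at most [n] points, or [f' = 0] and [|f| = |f - f'|]. *)
Lemma rnorm_truncation f f' (t d C e : R) (n : nat) :
  Cc f -> Cc f' -> 0 < t -> 0 < d -> 0 <= C -> 0 <= e ->
  (forall y, 0 <= y -> expR (- t * y) ^+ 2 * (1 + Num.sqrt y) ^+ (2 * p) <= C ^+ 2) ->
  (forall x F, uniq F -> {in F, forall g, closure (osupp f') g} ->
    {in F, forall g, sfib G x g} \/ {in F, forall g, rfib G x g} -> (size F <= n)%N) ->
  (rnorm (fun sigma => (f sigma - f' sigma)%R) <= e%:E)%E ->
  (rnorm (fun sigma => ((heat (psi := psi) t (pi sigma))%:C * f sigma - truncation t d f sigma)%R)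
    <= (c * (C * (e + 2 * d * n%:R)))%:E)%E.
Proof.
move=> Cf Cf' t0 d0 C0 e0 decay nK ff'.
have dn0 : 0 <= 2 * d * n%:R by rewrite mulr_ge0// mulr_ge0// ltW.
have Cff' := CcB Cf Cf'.
apply: rnorm_rapid_decay.
- exact: CcB (Cc_heat _ Cf) (Cc_truncation _ _ Cf).
- by rewrite mulr_ge0// addr_ge0.
move=> x F ux uF Fx.
pose u g := cabs (f (lift g) - f' (lift g)) ^+ 2.
pose v g : R := if `[< closure (osupp f') g >] then (2 * d) ^+ 2 else 0.
have main g : cabs ((heat (psi := psi) t (pi (lift g)))%:C * f (lift g) -
      truncation t d f (lift g)) ^+ 2 * (1 + L g) ^+ (2 * p) <= C ^+ 2 * (u g + v g).
  rewrite /truncation -mulrBl -[_ - _]rmorphB/= pi_tw_lift -{1}[heat t g]mulr1 -mulrBr.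
  set s := cabs (f (lift g)).
  rewrite cabsM cabs_real ?mulr_ge0 ?heat_ge0 ?subr_ge0 ?cutoff_le1// -/s.
  rewrite [leLHS](_ : _ = heat (psi := psi) t g ^+ 2 * (1 + L g) ^+ (2 * p) *
    ((1 - cutoff d s) * s) ^+ 2); last first.
    by move: (_ ^+ (2 * p)) => X; ring.
  apply: ler_pM; rewrite ?sqr_ge0//.
  - by rewrite mulr_ge0 ?sqr_ge0// exprn_ge0// addr_ge0// sqrtr_ge0.
  - exact/decay/(neg_type_ge0 GG Hpsi).
  have s0 : 0 <= s := cabs_ge0 _.
  have k0 := cutoff_ge0 d s; have k1 := cutoff_le1 d s.
  rewrite /v; case: asboolP => [_|ng].
    apply: ler_wpDl; first exact: sqr_ge0.
    have [sd|sd] := leP (2 * d) s.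
      by rewrite cutoff_eq1// subrr mul0r expr0n/= sqr_ge0.
    apply: lerXn2r; rewrite ?nnegrE ?mulr_ge0 ?subr_ge0// ?(ltW d0)//.
    by apply: le_trans (ltW sd); rewrite ler_piMl// gerBl.
  have /eqP := osupp_lift Cf' ng; rewrite cabs_eq0 => /eqP f'0.
  rewrite addr0 /u f'0 subr0 -/s; apply: lerXn2r; rewrite ?nnegrE ?mulr_ge0 ?subr_ge0//.
  by rewrite ler_piMl// gerBl.
apply: le_trans (ler_sum _ (fun g _ => main g)) _.
rewrite -mulr_sumr exprMn ler_wpM2l ?sqr_ge0// big_split/=.
(* The reduced norm dominates the 2-norm on source fibres and on range fibres alike. *)
have us : \sum_(g <- F) u g <= e ^+ 2.
  by case: Fx => Fx; [exact: (rnorm_ge_sfib HG HS Cff' e0 ff' ux)|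
    exact: (rnorm_ge_rfib HG HS Cff' e0 ff' ux)].
have vs : \sum_(g <- F) v g <= (2 * d * n%:R) ^+ 2.
  rewrite /v -big_mkcond/= -big_filter big_const_seq count_predT iter_addr_0 -[leLHS]mulr_natr.
  rewrite [leRHS]exprMn ler_wpM2l ?sqr_ge0//.
  apply: (@le_trans _ _ n%:R).
    rewrite ler_nat; apply: (nK x); first exact: filter_uniq.
      by move=> g; rewrite mem_filter => /andP[/asboolP].
    by case: Fx => Fx; [left|right] => g; rewrite mem_filter => /andP[_ /Fx].
  by rewrite -natrX ler_nat; case: (n) => // k; rewrite -mulnn leq_pmulr.
apply: le_trans (lerD us vs) _; rewrite sqrrD -addrA lerD2l lerDr.
by rewrite mulrn_wge0// mulr_ge0.
Qed.

End RapidDecay.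
End Approximation.

Unset Implicit Arguments.
Local Close Scope complex_scope.

Theorem theorem4p8 (R : realType) (T : topologicalType) (G : groupoid T)
  (S : twist R G) (psi : T -> R) (f : tw_sp S -> Cx R) :
  lch_etale_groupoid G -> is_twist S ->
  loc_proper_neg_type G psi -> (exists g, psi g != 0) ->
  rapid_decay S (fun g => Num.sqrt (psi g)) ->
  in_Cr f ->
  forall fn : nat -> tw_sp S -> Cx R, represents fn f ->
  forall eps : R, 0 < eps ->
    exists h : tw_sp S -> Cx R, Cc_on (osupp f) h /\
      exists N, forall n, (N <= n)%N ->
        (rnorm (fun sigma : tw_sp S => (fn n sigma - h sigma)%R) < eps%:E)%E.
Proof.
move=> HG HS Hpsi _ [c [c0 [p RD]]] _ fn [Cfn cauchy unif] eps eps0.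
(* Four errors of size [e1] are combined by three uses of [rnorm_add], which gives [22 * e1] in
   total. *)
pose e1 : R := eps / 32.
have e10 : 0 < e1 by rewrite divr_gt0.
have [N0 HN0] := cauchy _ e10.
have [t [t0 Ht]] := rnorm_heat_approx HG HS Hpsi c0 RD (Cfn N0) e10.
have [C [C0 decay]] := expR_decay p t0.
have cC0 : 0 <= c * C by rewrite mulr_ge0// ltW.
(* Chosen so that [c * C * (e2 + e2) <= e1]; the added 1 keeps the denominator positive. *)
pose e2 : R := e1 / (2 * (c * C + 1)).
have e20 : 0 < e2 by rewrite divr_gt0// mulr_gt0// ltr_wpDl.
have [N1 HN1] := cauchy _ e20.
have [_ _ kf] := Cfn N1.
have [n nK] := compact_fib_bound HG kf.
(* Ensures [2 * d * n <= e2], also for [n = 0]. The bound [n] comes from the fixed [fn N1], so [d]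
   is known before the late index [M] is chosen. *)
pose d : R := e2 / (2 * n.+1%:R).
have d0 : 0 < d by rewrite divr_gt0// mulr_gt0.
have [N2 HN2] := unif _ d0.
pose M := maxn N0 (maxn N1 N2).
have M0 : (N0 <= M)%N by rewrite leq_maxl.
have M1 : (N1 <= M)%N by rewrite /M !leq_max leqnn orbT.
have M2 : (N2 <= M)%N by rewrite /M !leq_max leqnn !orbT.
pose h := truncation (psi := psi) t d (fn M).
have Ch : Cc h := Cc_truncation HG HS Hpsi t d (Cfn M).
exists h; split.
  (* On the closed support of [h] the modulus of [fn M] is at least [d], while [fn M] is within less
     than [d] of [f]; hence [f] does not vanish there. *)
  split=> // g /(closure_osupp_truncation HS (Cfn M) d0) dg.
  exists (tw_lift HS g); split; first exact: pi_tw_lift.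
  apply/eqP => fg; have := HN2 M M2 (tw_lift HS g).
  by rewrite fg subr0 ltNge dg.
(* The difference [fn m - h] splits into [fn m - fn N0], [fn N0 - ph (fn N0)], [ph (fn N0 - fn M)]
   and [ph (fn M) - h]. The multiplier is compared with the identity only at the fixed [fn N0], and
   contractivity carries it over to [fn M]. *)
exists N0 => m m0.
pose ph (k : tw_sp S -> Cx R) (sigma : tw_sp S) : Cx R :=
  (heat (psi := psi) t (tw_pi S sigma))%:C%C * k sigma.
have Cph k : Cc k -> Cc (ph k) by exact: Cc_heat.
have r4 : (rnorm (fun sigma => (ph (fn M) sigma - h sigma)%R) <= e1%:E)%E.
  have e2' := HN1 _ _ M1 (leqnn N1).
  apply: le_trans (rnorm_truncation HG HS Hpsi c0 RD (Cfn M) (Cfn N1) t0 d0 C0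
    (ltW e20) decay nK (ltW e2')) _.
  rewrite lee_fin mulrA.
  have dn : 2 * d * n%:R <= e2.
    rewrite [leLHS](_ : _ = e2 * (n%:R / n.+1%:R)); last first.
      have : n.+1%:R != 0 :> R by rewrite pnatr_eq0.
      by rewrite /d; move: (n.+1%:R) => k k0; field; rewrite k0.
    by rewrite ler_piMr ?(ltW e20)// ler_pdivrMr ?ltr0n// mul1r ler_nat.
  apply: (@le_trans _ _ (c * C * (e2 + e2))); first by rewrite ler_wpM2l// lerD2l.
  rewrite [leLHS](_ : _ = e1 * (c * C / (c * C + 1))); last by rewrite /e2; field; lra.
  by rewrite ler_piMr ?(ltW e10)// ler_pdivrMr ?ltr_wpDl// mul1r lerDl.
have r3 : (rnorm (ph (fun sigma => (fn N0 sigma - fn M sigma)%R)) <= e1%:E)%E.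
  apply: (rnorm_schur HG HS (phi := heat (psi := psi) t)).
  - exact: (continuous_heat Hpsi).
  - by move=> x k gam; apply: heat_kernel (etale_groupoid HG) Hpsi _ _ _ _ (ltW t0).
  - by move=> x ux; exact: (heat_unit Hpsi).
  - exact: CcB.
  - exact: ltW.
  - exact/ltW/HN0.
have r1 : (rnorm (fun sigma => (fn m sigma - fn N0 sigma)%R) <= e1%:E)%E.
  exact/ltW/HN0.
have E1 := ltW e10.
have C4 := CcB (Cph _ (Cfn M)) Ch.
have C3 := Cph _ (CcB (Cfn N0) (Cfn M)).
have C2 := CcB (Cfn N0) (Cph _ (Cfn N0)).
have C1 := CcB (Cfn m) (Cfn N0).
have E34 : 0 <= 2 * (e1 + e1) by rewrite mulr_ge0 ?addr_ge0.
have E234 : 0 <= 2 * (e1 + 2 * (e1 + e1)) by rewrite mulr_ge0 ?addr_ge0.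
have r34 := rnorm_add HG HS C3 C4 E1 E1 r3 r4.
have r234 := rnorm_add HG HS C2 (CcD C3 C4) E1 E34 Ht r34.
have r1234 := rnorm_add HG HS C1 (CcD C2 (CcD C3 C4)) E1 E234 r1 r234.
apply: le_lt_trans (_ : _ <= (2 * (e1 + 2 * (e1 + 2 * (e1 + e1))))%:E)%E _; last first.
  by rewrite lte_fin /e1; lra.
apply: le_trans r1234; rewrite le_eqVlt; apply/orP; left; apply/eqP.
congr rnorm; apply/funext => sigma; rewrite /ph; ring.
Qed.
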